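(* Let $f$ and $g$ be odd analytic functions in $\mathbb{D}$ with Taylor expansions $f(z)=\sum_{k=1}^\infty a_{2k-1}z^{2k-1}$ and $g(z)=\sum_{k=1}^\infty b_{2k-1}z^{2k-1}$, respectively. If $f$ is subordinate to $g$ in $\mathbb{D}$, then $$\sum_{k=1}^\infty |a_{2k-1}|\, r^{2k-1}\le \sum_{k=1}^\infty |b_{2k-1}|\, r^{2k-1}\quad\text{for all } 0\le r\le \frac{1}{\sqrt3}.$$
   Context: $\mathbb{D}=\{z\in\mathbb{C}: |z|<1\}$. For analytic functions $f,g$ in $\mathbb{D}$, $f$ is subordinate to $g$ (written $f\prec g$) if there is a function $\omega$, analytic in $\mathbb{D}$, with $\omega(0)=0$ and $|\omega(z)|\le 1$ for $|z|<1$, such that $f(z)=g(\omega(z))$ for all $z\in\mathbb{D}$. *)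

(* Defs.v *)
From Stdlib Require Export Reals.
From Coquelicot Require Export Coquelicot.
Open Scope R_scope.

Definition unit_disk (z : C) : Prop := Cmod z < 1.

(* [C] is viewed as a normed module over itself, so [ex_derive] is
   complex (not merely real) differentiability.  The disk is open, hence
   the values of [f] outside it are irrelevant. *)
Definition analytic_in_disk (f : C -> C) : Prop :=
  forall z : C, unit_disk z ->
    ex_derive (K := C_AbsRing) (V := C_NormedModule) f z.

Definition odd_in_disk (f : C -> C) : Prop :=
  forall z : C, unit_disk z -> f (- z)%C = (- f z)%C.

(* Only odd-indexed coefficients are used: with [k] shifted by one,
   [a (2 * k + 1)] runs over a_1, a_3, a_5, ... *)
Definition odd_taylor_expansion (f : C -> C) (a : nat -> C) : Prop :=
  forall z : C, unit_disk z ->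
    is_series (K := C_AbsRing) (V := C_NormedModule)
      (fun k : nat => (a (2 * k + 1)%nat * z ^ (2 * k + 1))%C) (f z).

(* The bound on [w] is non-strict; by the Schwarz lemma [w] nevertheless maps
   the open disk into itself, so [g] is only evaluated inside the disk. *)
Definition subordinate (f g : C -> C) : Prop :=
  exists w : C -> C,
    analytic_in_disk w /\
    w (RtoC 0) = RtoC 0 /\
    (forall z : C, unit_disk z -> Cmod (w z) <= 1) /\
    (forall z : C, unit_disk z -> f z = g (w z)).

Definition odd_majorant_term (a : nat -> C) (r : R) (k : nat) : R :=
  Cmod (a (2 * k + 1)%nat) * r ^ (2 * k + 1).

(* Main.v *)
Require Import Defs.
From Stdlib Require Import Reals Arith Lra Lia.
From Coquelicot Require Import Coquelicot.

(** Pulled back by [cexp] to the left half-plane, a holomorphic function on the disk becomes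
    [2 pi i]-periodic, and Goursat's lemma makes its integral over a vertical period
    independent of the abscissa [s].  This gives Taylor coefficients (no power series expansion
    of the inner function is needed), and shows that those of negative index vanish.

    If [f = g o w], write [w (cexp z) = v z * cexp z].  Comparing coefficients on a small circle,
    [a_N] is the sum over odd [m <= N] of [b_m c_(N-m) (v^m)], where [c_l] denotes the [l]-th
    coefficient.  Since [Cmod (v^m) <= exp (- m s)] tends to [1] as [s -> 0], Bohr's argument gives
    [Cmod (c_l (v^m)) <= 2 (1 - Cmod (c_0 (v^m)))] for [l >= 1].  As [N] and [m] are odd, only
    even [l = 2 k] occur: the geometric series has ratio [r^2 <= 1/3], so the sum over [N] of
    [Cmod (c_(N-m) (v^m)) r^N] is at most [r^m]. *)

(** * Integrals of complex-valued functions *)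

(** The inner function [w] is known only to be complex differentiable, so its coefficients have to
    come from Cauchy theory. The exponential keeps that theory small: circles become vertical
    segments, and an annulus becomes a rectangle whose horizontal sides cancel by periodicity, so no
    curved path occurs. The price is that the centre of the disk moves to [Re z = -oo], where
    boundedness stands in for holomorphy; for [v] it comes from [w 0 = 0] and the differentiability
    of [w] at 0. On the line [Re z = s] the hypothesis on [w] bounds [v] only by [exp (- s)], which
    exceeds 1; the limit is legitimate because the coefficients themselves do not depend on [s]. The
    factor 2 in Bohr's estimate comes from testing a nonnegative function against a unimodular
    exponential. With x = r^2, the inequality 2x/(1-x) <= 1 holds exactly when x <= 1/3, whence the
    radius 1/sqrt 3. *)

Definition CInt (f : R -> C) (a b : R) : C := RInt (V := C_R_CompleteNormedModule) f a b.
Definition Cintegrable (f : R -> C) (a b : R) : Prop := ex_RInt (V := C_R_NormedModule) f a b.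
Definition Ccont (f : R -> C) (t : R) : Prop := continuous (T := R_UniformSpace) (U := C_UniformSpace) f t.

Lemma Cintegrable_cont f a b : (forall t, a <= t <= b -> Ccont f t) -> a <= b -> Cintegrable f a b.
Proof.
intros H Hab. apply (ex_RInt_continuous (V := C_R_CompleteNormedModule)).
intros z Hz. rewrite Rmin_left, Rmax_right in Hz by lra. now apply H.
Qed.

Lemma CInt_minus f g a b : Cintegrable f a b -> Cintegrable g a b ->
  CInt (fun t => f t - g t)%C a b = (CInt f a b - CInt g a b)%C.
Proof. intros Hf Hg. exact (RInt_minus (V := C_R_CompleteNormedModule) f g a b Hf Hg). Qed.

Lemma is_CInt_pair f a b (l : C) :
  is_RInt (V := C_R_NormedModule) f a b l <->
  is_RInt (fun t => Re (f t)) a b (Re l) /\ is_RInt (fun t => Im (f t)) a b (Im l).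
Proof.
split.
- intros H. split.
  + exact (is_RInt_fct_extend_fst (U := R_NormedModule) (V := R_NormedModule) f a b l H).
  + exact (is_RInt_fct_extend_snd (U := R_NormedModule) (V := R_NormedModule) f a b l H).
- intros [H1 H2]. destruct l as [l1 l2].
  exact (is_RInt_fct_extend_pair (U := R_NormedModule) (V := R_NormedModule) f a b l1 l2 H1 H2).
Qed.

Lemma CInt_correct f a b : Cintegrable f a b -> is_RInt (V := C_R_NormedModule) f a b (CInt f a b).
Proof. intros H. exact (RInt_correct (V := C_R_CompleteNormedModule) f a b H). Qed.

Lemma is_CInt_unique f a b l : is_RInt (V := C_R_NormedModule) f a b l -> CInt f a b = l.
Proof. intros H. exact (is_RInt_unique (V := C_R_CompleteNormedModule) f a b l H). Qed.

(** The module structure used for integration is over the reals, so a complex factor is not a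
    [scal]; expanding the product into real and imaginary parts reduces it to four real
    multiples. *)
Lemma is_CInt_scal c f a b l : is_RInt (V := C_R_NormedModule) f a b l ->
  is_RInt (V := C_R_NormedModule) (fun t => c * f t)%C a b (c * l)%C.
Proof.
intros H. apply is_CInt_pair in H. destruct H as [H1 H2]. apply is_CInt_pair. split.
- exact (is_RInt_minus _ _ a b _ _ (is_RInt_scal _ a b (Re c) _ H1) (is_RInt_scal _ a b (Im c) _ H2)).
- exact (is_RInt_plus _ _ a b _ _ (is_RInt_scal _ a b (Re c) _ H2) (is_RInt_scal _ a b (Im c) _ H1)).
Qed.

Lemma is_CInt_conj f a b l : is_RInt (V := C_R_NormedModule) f a b l ->
  is_RInt (V := C_R_NormedModule) (fun t => Cconj (f t)) a b (Cconj l).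
Proof.
intros H. apply is_CInt_pair in H. destruct H as [H1 H2]. apply is_CInt_pair. split.
- exact H1.
- exact (is_RInt_opp _ a b _ H2).
Qed.

Lemma Cintegrable_scal c f a b : Cintegrable f a b -> Cintegrable (fun t => c * f t)%C a b.
Proof. intros H. eexists. apply is_CInt_scal. now apply CInt_correct. Qed.

Lemma CInt_scal c f a b : Cintegrable f a b -> CInt (fun t => c * f t)%C a b = (c * CInt f a b)%C.
Proof. intros H. apply is_CInt_unique, is_CInt_scal. now apply CInt_correct. Qed.

Lemma Cintegrable_minus f g a b : Cintegrable f a b -> Cintegrable g a b -> Cintegrable (fun t => f t - g t)%C a b.
Proof. intros Hf Hg. exact (ex_RInt_minus (V := C_R_NormedModule) f g a b Hf Hg). Qed.

Lemma Cintegrable_ext f g a b : (forall t, f t = g t) -> Cintegrable f a b -> Cintegrable g a b.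
Proof. intros H. apply (ex_RInt_ext (V := C_R_NormedModule)). auto. Qed.

Lemma CInt_Chasles f a b c : Cintegrable f a b -> Cintegrable f b c ->
  CInt f a c = (CInt f a b + CInt f b c)%C.
Proof. intros Hf Hg. symmetry. exact (RInt_Chasles (V := C_R_CompleteNormedModule) f a b c Hf Hg). Qed.

Lemma CInt_ext f g a b : a <= b -> (forall t, a <= t <= b -> f t = g t) -> CInt f a b = CInt g a b.
Proof.
intros Hab H. apply (RInt_ext (V := C_R_CompleteNormedModule)).
intros t Ht. rewrite Rmin_left, Rmax_right in Ht by lra. apply H. lra.
Qed.

Lemma norm_C_R (z : C) : norm (V := C_R_NormedModule) z = Cmod z.
Proof.
unfold norm; simpl. unfold prod_norm, Cmod. simpl. unfold norm; simpl. unfold abs; simpl.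
rewrite !Rmult_1_r, <- !Rabs_mult, !Rabs_pos_eq by nra. reflexivity.
Qed.

Lemma CInt_norm_le f g a b : a <= b -> Cintegrable f a b -> ex_RInt g a b ->
  (forall t, a <= t <= b -> Cmod (f t) <= g t) -> Cmod (CInt f a b) <= RInt g a b.
Proof.
intros Hab Hf Hg H. rewrite <- norm_C_R.
apply (norm_RInt_le (V := C_R_NormedModule) f g a b).
- exact Hab.
- intros t Ht. rewrite norm_C_R. now apply H.
- now apply CInt_correct.
- exact (RInt_correct (V := R_CompleteNormedModule) g a b Hg).
Qed.

Lemma CInt_bound f M a b : a <= b -> Cintegrable f a b ->
  (forall t, a <= t <= b -> Cmod (f t) <= M) -> Cmod (CInt f a b) <= M * (b - a).
Proof.
intros Hab Hf H. replace (M * (b - a)) with (RInt (fun _ => M) a b).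
- apply CInt_norm_le; auto. apply ex_RInt_const.
- rewrite RInt_const. unfold scal; simpl; unfold mult; simpl. ring.
Qed.

Lemma CInt_affine (p q : C) a b :
  is_RInt (V := C_R_NormedModule) (fun t => p + RtoC t * q)%C a b
   (RtoC (b - a) * p + RtoC ((b ^ 2 - a ^ 2) / 2) * q)%C.
Proof.
assert (K : forall p q a b : R,
  is_RInt (fun t => p + t * q) a b ((b - a) * p + ((b ^ 2 - a ^ 2) / 2) * q)).
{ clear. intros p q a b.
  replace ((b - a) * p + (b ^ 2 - a ^ 2) / 2 * q) with
   (minus ((fun t => p * t + t ^ 2 / 2 * q) b) ((fun t => p * t + t ^ 2 / 2 * q) a)).
  2:{ unfold minus, plus, opp; simpl. field. }
  apply (is_RInt_derive (V := R_CompleteNormedModule) (fun t => p * t + t ^ 2 / 2 * q)).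
  - intros t _. auto_derive; auto. field.
  - intros t _. apply continuity_pt_filterlim. reg. }
apply is_CInt_pair. split.
- eapply is_RInt_ext. 2:{ replace (Re _) with ((b - a) * Re p + ((b ^ 2 - a ^ 2) / 2) * Re q). apply K. simpl. unfold Re. ring. }
  intros t _. simpl. unfold Re. ring.
- eapply is_RInt_ext. 2:{ replace (Im _) with ((b - a) * Im p + ((b ^ 2 - a ^ 2) / 2) * Im q). apply K. simpl. unfold Im. ring. }
  intros t _. simpl. unfold Im. ring.
Qed.

(** * Complex differentiability and Goursat's lemma on rectangles *)

Lemma Ccont_eps f t : Ccont f t <-> forall eps, 0 < eps -> exists delta, 0 < delta /\
  forall u, Rabs (u - t) < delta -> Cmod (f u - f t) < eps.
Proof.
split.
- intros H eps He.
  (* Balls of the uniform structure on [C] are coordinatewise squares, on which [Cmod] is controlled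
     only up to the factor [sqrt 2]. *)
  assert (He' : 0 < eps / sqrt 2) by (apply Rdiv_lt_0_compat; [lra | apply sqrt_lt_R0; lra]).
  destruct (proj1 (filterlim_locally _ _) H (mkposreal _ He')) as [d Hd].
  exists d. split. apply cond_pos. intros u Hu.
  specialize (Hd u Hu). apply (C_NormedModule_mixin_compat2 (f t) (f u)) in Hd.
  simpl in Hd. replace (sqrt 2 * (eps / sqrt 2)) with eps in Hd. exact Hd.
  field. apply Rgt_not_eq, sqrt_lt_R0. lra.
- intros H. apply filterlim_locally. intros eps.
  destruct (H eps (cond_pos eps)) as [d [Hd H']].
  exists (mkposreal d Hd). intros u Hu. apply C_NormedModule_mixin_compat1. apply H'. exact Hu.
Qed.

(** The bound is non-strict and has no quotient, so [h = 0] needs no separate case and the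
    first-order remainder can be estimated directly under an integral. *)
Definition Cdiff (f : C -> C) (z : C) : Prop := exists l : C,
  forall eps, 0 < eps -> exists delta, 0 < delta /\
    forall h, Cmod h < delta -> Cmod (f (z + h) - f z - l * h)%C <= eps * Cmod h.

Lemma Cdiff_lip f z : Cdiff f z -> exists K delta, 0 < K /\ 0 < delta /\
  forall h, Cmod h < delta -> Cmod (f (z + h) - f z)%C <= K * Cmod h.
Proof.
intros [l H]. destruct (H 1 Rlt_0_1) as [d [Hd H']].
exists (Cmod l + 1), d. pose proof (Cmod_ge_0 l). repeat split; try lra.
intros h Hh. replace (f (z + h) - f z)%C with ((f (z + h) - f z - l * h) + l * h)%C by ring.
eapply Rle_trans. apply Cmod_triangle. rewrite Cmod_mult. specialize (H' h Hh). lra.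
Qed.

Lemma Cdiff_comp_cont f p t : Cdiff f (p t) -> Ccont p t -> Ccont (fun u => f (p u)) t.
Proof.
intros Hf Hp. apply Ccont_eps. intros eps He.
destruct (Cdiff_lip _ _ Hf) as (K & d & HK & Hd & H).
destruct (proj1 (Ccont_eps _ _) Hp (Rmin d (eps / K))) as [d' [Hd' H']].
{ apply Rmin_pos; auto. now apply Rdiv_lt_0_compat. }
exists d'. split; auto. intros u Hu. specialize (H' u Hu).
pose proof (Rmin_l d (eps / K)). pose proof (Rmin_r d (eps / K)).
replace (p u) with (p t + (p u - p t))%C by ring.
eapply Rle_lt_trans. apply H. lra.
apply Rlt_le_trans with (K * (eps / K)). apply Rmult_lt_compat_l; lra. right. field. lra.
Qed.

Lemma Cmod_pair_le (x y : R) : Cmod (x, y) <= Rabs x + Rabs y.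
Proof.
replace (x, y) with (RtoC x + Ci * RtoC y)%C by (apply injective_projections; simpl; ring).
eapply Rle_trans. apply Cmod_triangle. rewrite Cmod_mult, !Cmod_R, Cmod_Ci. lra.
Qed.

Lemma Ccont_horizontal (y t : R) : Ccont (fun x => (x, y)) t.
Proof.
apply Ccont_eps. intros eps He. exists eps. split; auto. intros u Hu.
eapply Rle_lt_trans. 2: exact Hu. eapply Rle_trans. apply Cmod_pair_le. simpl.
replace (y + - y) with 0 by ring. rewrite Rabs_R0. unfold Rminus. lra.
Qed.

Lemma Ccont_vertical (x t : R) : Ccont (fun y => (x, y)) t.
Proof.
apply Ccont_eps. intros eps He. exists eps. split; auto. intros u Hu.
eapply Rle_lt_trans. 2: exact Hu. eapply Rle_trans. apply Cmod_pair_le. simpl.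
replace (x + - x) with 0 by ring. rewrite Rabs_R0. unfold Rminus. lra.
Qed.

Definition on_rect (P : C -> Prop) (a b c d : R) :=
  forall x y : R, a <= x <= b -> c <= y <= d -> P (x, y).

(** The contour integral of [F dz], counterclockwise: [dz] is [dx] on the horizontal sides and
    [Ci * dy] on the vertical ones. *)
Definition boundary_int (F : C -> C) (a b c d : R) : C :=
  (CInt (fun x => F (x, c)) a b - CInt (fun x => F (x, d)) a b
   + Ci * (CInt (fun y => F (b, y)) c d - CInt (fun y => F (a, y)) c d))%C.

Lemma Cintegrable_horizontal F a b c d y : on_rect (Cdiff F) a b c d -> a <= b -> c <= y <= d ->
  Cintegrable (fun x => F (x, y)) a b.
Proof.
intros H Hab Hy. apply Cintegrable_cont; auto. intros t Ht.
apply (Cdiff_comp_cont F (fun x => (x, y))). now apply H. apply Ccont_horizontal.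
Qed.

Lemma Cintegrable_vertical F a b c d x : on_rect (Cdiff F) a b c d -> c <= d -> a <= x <= b ->
  Cintegrable (fun y => F (x, y)) c d.
Proof.
intros H Hcd Hx. apply Cintegrable_cont; auto. intros t Ht.
apply (Cdiff_comp_cont F (fun y => (x, y))). now apply H. apply Ccont_vertical.
Qed.

Lemma on_rect_sub P a b c d a' b' c' d' : on_rect P a b c d ->
  a <= a' -> b' <= b -> c <= c' -> d' <= d -> on_rect P a' b' c' d'.
Proof. intros H ? ? ? ? x y Hx Hy. apply H; lra. Qed.

Lemma boundary_int_split F a m b c n d : on_rect (Cdiff F) a b c d ->
  a <= m <= b -> c <= n <= d ->
  boundary_int F a b c d =
   (boundary_int F a m c n + boundary_int F m b c n
    + (boundary_int F a m n d + boundary_int F m b n d))%C.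
Proof.
intros H Hm Hn. unfold boundary_int.
rewrite (CInt_Chasles (fun x => F (x, c)) a m b), (CInt_Chasles (fun x => F (x, d)) a m b),
 (CInt_Chasles (fun y => F (a, y)) c n d), (CInt_Chasles (fun y => F (b, y)) c n d).
ring.
all: [> apply (Cintegrable_vertical F a b c n) | apply (Cintegrable_vertical F a b n d)
 | apply (Cintegrable_vertical F a b c n) | apply (Cintegrable_vertical F a b n d)
 | apply (Cintegrable_horizontal F a m c d) | apply (Cintegrable_horizontal F m b c d)
 | apply (Cintegrable_horizontal F a m c d) | apply (Cintegrable_horizontal F m b c d) ];
 try lra; apply (on_rect_sub _ a b c d); auto; lra.
Qed.

Definition quarter_step (F : C -> C) (q : R * R * R * R) : R * R * R * R :=
  let '(a, b, c, d) := q in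
  let m := (a + b) / 2 in
  let n := (c + d) / 2 in
  let K := Cmod (boundary_int F a b c d) / 4 in
  if Rle_dec K (Cmod (boundary_int F a m c n)) then (a, m, c, n) else
  if Rle_dec K (Cmod (boundary_int F m b c n)) then (m, b, c, n) else
  if Rle_dec K (Cmod (boundary_int F a m n d)) then (a, m, n, d) else (m, b, n, d).

Lemma quarter_step_spec F a b c d a' b' c' d' : on_rect (Cdiff F) a b c d ->
  a <= b -> c <= d -> quarter_step F (a, b, c, d) = (a', b', c', d') ->
  (a <= a' /\ b' <= b /\ b' - a' = (b - a) / 2) /\
  (c <= c' /\ d' <= d /\ d' - c' = (d - c) / 2) /\
  Cmod (boundary_int F a b c d) / 4 <= Cmod (boundary_int F a' b' c' d').
Proof.
intros H Hab Hcd. unfold quarter_step.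
set (m := (a + b) / 2). set (n := (c + d) / 2).
pose proof (boundary_int_split F a m b c n d H) as S.
assert (Hm : a <= m <= b) by (unfold m; lra). assert (Hn : c <= n <= d) by (unfold n; lra).
specialize (S Hm Hn).
repeat destruct Rle_dec; intros E; injection E as <- <- <- <-;
  (split; [|split]; [unfold m; lra | unfold n; lra | try assumption]).
(* Only the fourth quarter, taken untested, is left. The other three failed the test, so each
   contributes less than a fourth; by the triangle inequality on [S] the last one must contribute at
   least a fourth. *)
pose proof (Cmod_triangle (boundary_int F a m c n + boundary_int F m b c n)
  (boundary_int F a m n d + boundary_int F m b n d)) as T.
rewrite <- S in T.
pose proof (Cmod_triangle (boundary_int F a m c n) (boundary_int F m b c n)).
pose proof (Cmod_triangle (boundary_int F a m n d) (boundary_int F m b n d)).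
lra.
Qed.

Lemma nested_intervals (u v : nat -> R) : (forall n, u n <= u (S n)) ->
  (forall n, v (S n) <= v n) -> (forall n, u n <= v n) ->
  exists x, forall n, u n <= x <= v n.
Proof.
intros Hu Hv Huv.
assert (Iu : forall n k, u n <= u (n + k)%nat).
{ intros n k. induction k. rewrite Nat.add_0_r. lra. rewrite Nat.add_succ_r. specialize (Hu (n + k)%nat). lra. }
assert (Iv : forall n k, v (n + k)%nat <= v n).
{ intros n k. induction k. rewrite Nat.add_0_r. lra. rewrite Nat.add_succ_r. specialize (Hv (n + k)%nat). lra. }
assert (B : forall n k, u n <= v k).
{ intros n k. specialize (Iu n k). specialize (Iv k n). specialize (Huv (n + k)%nat).
  rewrite (Nat.add_comm k n) in Iv. lra. }
destruct (completeness (fun x => exists n, x = u n)) as [x [H1 H2]].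
- exists (v 0%nat). intros y [n ->]. apply B.
- exists (u 0%nat). now exists 0%nat.
- exists x. intros n. split.
  + apply H1. now exists n.
  + apply H2. intros y [k ->]. apply B.
Qed.

Lemma boundary_int_affine (p q : C) a b c d : a <= b -> c <= d ->
  boundary_int (fun z => p + q * z)%C a b c d = 0.
Proof.
intros Hab Hcd. unfold boundary_int.
assert (Hx : forall y, CInt (fun x => p + q * (x, y))%C a b =
  (RtoC (b - a) * (p + q * (0, y)) + RtoC ((b ^ 2 - a ^ 2) / 2) * q)%C).
{ intros y. erewrite <- is_CInt_unique. 2: apply CInt_affine. apply CInt_ext; auto.
  intros t _. apply injective_projections; simpl; ring. }
assert (Hy : forall x, CInt (fun y => p + q * (x, y))%C c d =
  (RtoC (d - c) * (p + q * RtoC x) + RtoC ((d ^ 2 - c ^ 2) / 2) * (q * Ci))%C).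
{ intros x. erewrite <- is_CInt_unique. 2: apply CInt_affine. apply CInt_ext; auto.
  intros t _. apply injective_projections; simpl; ring. }
rewrite !Hx, !Hy. apply injective_projections; simpl; field.
Qed.

Lemma Cdiff_affine (p q z : C) : Cdiff (fun z => p + q * z)%C z.
Proof.
exists q. intros eps He. exists 1. split. lra. intros h _.
replace (_ - _ - _)%C with (RtoC 0) by ring. rewrite Cmod_0.
apply Rmult_le_pos. lra. apply Cmod_ge_0.
Qed.

Lemma boundary_int_minus F G a b c d : on_rect (Cdiff F) a b c d -> on_rect (Cdiff G) a b c d ->
  a <= b -> c <= d ->
  boundary_int (fun z => F z - G z)%C a b c d = (boundary_int F a b c d - boundary_int G a b c d)%C.
Proof.
intros HF HG Hab Hcd. unfold boundary_int.
rewrite !CInt_minus. ring.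
1-4: apply (Cintegrable_vertical _ a b c d); auto; lra.
all: apply (Cintegrable_horizontal _ a b c d); auto; lra.
Qed.

Lemma Cdiff_minus F G z : Cdiff F z -> Cdiff G z -> Cdiff (fun z => F z - G z)%C z.
Proof.
intros [l Hl] [k Hk]. exists (l - k)%C. intros eps He.
destruct (Hl (eps / 2)) as [d [Hd H]]. lra. destruct (Hk (eps / 2)) as [e [He' H']]. lra.
exists (Rmin d e). split. now apply Rmin_pos. intros h Hh.
pose proof (Rmin_l d e). pose proof (Rmin_r d e).
replace (_ - _)%C with ((F (z + h) - F z - l * h) + - (G (z + h) - G z - k * h))%C by ring.
eapply Rle_trans. apply Cmod_triangle. rewrite Cmod_opp.
specialize (H h). specialize (H' h). lra.
Qed.

Lemma boundary_int_bound F M a b c d : on_rect (Cdiff F) a b c d -> a <= b -> c <= d ->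
  on_rect (fun z => Cmod (F z) <= M) a b c d ->
  Cmod (boundary_int F a b c d) <= 2 * M * ((b - a) + (d - c)).
Proof.
intros HF Hab Hcd HM. unfold boundary_int.
assert (Bx : forall y, c <= y <= d -> Cmod (CInt (fun x => F (x, y)) a b) <= M * (b - a)).
{ intros y Hy. apply CInt_bound; auto. eapply Cintegrable_horizontal; eauto. }
assert (By : forall x, a <= x <= b -> Cmod (CInt (fun y => F (x, y)) c d) <= M * (d - c)).
{ intros y Hy. apply CInt_bound; auto. eapply Cintegrable_vertical; eauto. }
unfold Cminus.
eapply Rle_trans. apply Cmod_triangle.
rewrite Cmod_mult, Cmod_Ci.
pose proof (Cmod_triangle (CInt (fun x => F (x, c)) a b) (- CInt (fun x => F (x, d)) a b)).
pose proof (Cmod_triangle (CInt (fun y => F (b, y)) c d) (- CInt (fun y => F (a, y)) c d)).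
rewrite Cmod_opp in *.
pose proof (Bx c). pose proof (Bx d). pose proof (By a). pose proof (By b). lra.
Qed.

(** Bisection: the n-th quarter keeps at least the fraction 1/4^n of the integral and shrinks to a
    point. Subtracting the tangent map at that point leaves the integral unchanged and makes the
    integrand at most [eps] times the half-perimeter L/2^n, so the integral is at most 2 eps
    L^2/4^n. *)
Lemma goursat_rectangle F a b c d : on_rect (Cdiff F) a b c d -> a <= b -> c <= d ->
  boundary_int F a b c d = 0.
Proof.
intros HF Hab Hcd.
set (S := fun n => Nat.iter n (quarter_step F) (a, b, c, d)).
set (A := fun n => let '(x, _, _, _) := S n in x).
set (B := fun n => let '(_, x, _, _) := S n in x).
set (C := fun n => let '(_, _, x, _) := S n in x).
set (D := fun n => let '(_, _, _, x) := S n in x).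
assert (ES : forall n, S n = (A n, B n, C n, D n)).
{ intros n. unfold A, B, C, D. destruct (S n) as [[[? ?] ?] ?]. reflexivity. }
assert (Inv : forall n,
  (a <= A n /\ B n <= b /\ B n - A n = (b - a) / 2 ^ n) /\
  (c <= C n /\ D n <= d /\ D n - C n = (d - c) / 2 ^ n) /\
  Cmod (boundary_int F a b c d) / 4 ^ n <= Cmod (boundary_int F (A n) (B n) (C n) (D n)) /\
  (A n <= A (n + 1)%nat /\ B (n + 1)%nat <= B n /\ C n <= C (n + 1)%nat /\ D (n + 1)%nat <= D n)).
{ intros n.
  assert (Step : forall n, 
    (a <= A n /\ B n <= b /\ B n - A n = (b - a) / 2 ^ n) ->
    (c <= C n /\ D n <= d /\ D n - C n = (d - c) / 2 ^ n) ->
    (A n <= A (n + 1)%nat /\ B (n + 1)%nat <= B n /\ B (n + 1)%nat - A (n + 1)%nat = (B n - A n) / 2) /\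
    (C n <= C (n + 1)%nat /\ D (n + 1)%nat <= D n /\ D (n + 1)%nat - C (n + 1)%nat = (D n - C n) / 2) /\
    Cmod (boundary_int F (A n) (B n) (C n) (D n)) / 4 <=
    Cmod (boundary_int F (A (n + 1)%nat) (B (n + 1)%nat) (C (n + 1)%nat) (D (n + 1)%nat))).
  { intros k H1 H2.
    assert (0 <= (b - a) / 2 ^ k) by (apply Rdiv_le_0_compat; [lra | apply pow_lt; lra]).
    assert (0 <= (d - c) / 2 ^ k) by (apply Rdiv_le_0_compat; [lra | apply pow_lt; lra]).
    apply quarter_step_spec; try lra. apply (on_rect_sub _ a b c d); auto; lra.
    rewrite <- !ES. replace (k + 1)%nat with (Datatypes.S k) by lia. reflexivity. }
  assert (I : (a <= A n /\ B n <= b /\ B n - A n = (b - a) / 2 ^ n) /\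
    (c <= C n /\ D n <= d /\ D n - C n = (d - c) / 2 ^ n) /\
    Cmod (boundary_int F a b c d) / 4 ^ n <= Cmod (boundary_int F (A n) (B n) (C n) (D n))).
  { induction n as [|n IH].
    - simpl. unfold A, B, C, D; simpl. lra.
    - destruct IH as (I1 & I2 & I3). destruct (Step n I1 I2) as (J1 & J2 & J3).
      replace (Datatypes.S n) with (n + 1)%nat by lia. rewrite !pow_add, !pow_1.
      assert (0 < 2 ^ n) by (apply pow_lt; lra). assert (0 < 4 ^ n) by (apply pow_lt; lra).
      replace ((b - a) / (2 ^ n * 2)) with ((b - a) / 2 ^ n / 2) by (field; lra).
      replace ((d - c) / (2 ^ n * 2)) with ((d - c) / 2 ^ n / 2) by (field; lra).
      replace (Cmod (boundary_int F a b c d) / (4 ^ n * 4)) with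
        (Cmod (boundary_int F a b c d) / 4 ^ n / 4) by (field; lra).
      lra. }
  destruct I as (I1 & I2 & I3). destruct (Step n I1 I2) as (J1 & J2 & J3). tauto. }
assert (P2 : forall n, 0 < 2 ^ n) by (intros; apply pow_lt; lra).
assert (LX : forall n, 0 <= (b - a) / 2 ^ n) by (intros; apply Rdiv_le_0_compat; [lra | auto]).
assert (LY : forall n, 0 <= (d - c) / 2 ^ n) by (intros; apply Rdiv_le_0_compat; [lra | auto]).
destruct (nested_intervals A B) as [x Hx].
{ intros n. destruct (Inv n) as (_ & _ & _ & ?). rewrite <- Nat.add_1_r. tauto. }
{ intros n. destruct (Inv n) as (_ & _ & _ & ?). rewrite <- Nat.add_1_r. tauto. }
{ intros n. specialize (LX n). destruct (Inv n) as (? & _). lra. }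
destruct (nested_intervals C D) as [y Hy].
{ intros n. destruct (Inv n) as (_ & _ & _ & ?). rewrite <- Nat.add_1_r. tauto. }
{ intros n. destruct (Inv n) as (_ & _ & _ & ?). rewrite <- Nat.add_1_r. tauto. }
{ intros n. specialize (LY n). destruct (Inv n) as (_ & ? & _). lra. }
assert (HD : Cdiff F (x, y)).
{ apply HF. apply (Hx 0%nat). apply (Hy 0%nat). }
destruct HD as [l Hl].
set (L := (b - a) + (d - c)).
apply Cmod_eq_0. apply Rle_antisym. 2: apply Cmod_ge_0.
apply Rnot_lt_le. intros Hpos.
(* Makes 2 eps L^2 equal to the fraction L^2/(L^2+1) of the modulus of the integral, strictly less
   than the whole. The [+ 1] also covers the degenerate rectangle [L = 0]. *)
set (eps := Cmod (boundary_int F a b c d) / (2 * (L ^ 2 + 1))).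
assert (HL : 0 <= L) by (unfold L; lra).
assert (He : 0 < eps) by (unfold eps; apply Rdiv_lt_0_compat; nra).
destruct (Hl eps He) as [del [Hdel Hest]].
assert (exists n, L / 2 ^ n < del) as [n Hn].
{ destruct (pow_lt_1_zero (/ 2)) with (y := del / (L + 1)) as [n Hn].
  rewrite Rabs_pos_eq; lra. apply Rdiv_lt_0_compat; lra.
  exists n. specialize (Hn n (le_n n)). rewrite Rabs_pos_eq, pow_inv in Hn.
  2: apply pow_le; lra.
  apply Rle_lt_trans with ((L + 1) * / 2 ^ n).
  apply Rmult_le_compat_r. apply Rlt_le, Rinv_0_lt_compat, P2. lra.
  apply Rmult_lt_compat_l with (r := L + 1) in Hn. 2: lra.
  replace ((L + 1) * (del / (L + 1))) with del in Hn by (field; lra). exact Hn. }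
set (T := fun z => (F (x, y) - l * (x, y) + l * z)%C).
assert (HFn : on_rect (Cdiff F) (A n) (B n) (C n) (D n)).
{ destruct (Inv n) as (? & ? & _). apply (on_rect_sub _ a b c d); auto; lra. }
assert (HTn : on_rect (Cdiff T) (A n) (B n) (C n) (D n)).
{ intros ? ? _ _. apply Cdiff_affine. }
destruct (Inv n) as (I1 & I2 & I3 & _). specialize (LX n). specialize (LY n).
assert (Eq : boundary_int (fun z => F z - T z)%C (A n) (B n) (C n) (D n) =
  boundary_int F (A n) (B n) (C n) (D n)).
{ rewrite boundary_int_minus; auto; try lra.
  unfold T at 1. rewrite boundary_int_affine by lra. ring. }
assert (Bd : Cmod (boundary_int F (A n) (B n) (C n) (D n)) <=
  2 * (eps * (L / 2 ^ n)) * (L / 2 ^ n)).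
{ rewrite <- Eq. eapply Rle_trans. apply boundary_int_bound with (M := eps * (L / 2 ^ n)); try lra.
  - intros u v Hu Hv. apply Cdiff_minus. now apply HFn. now apply HTn.
  - intros u v Hu Hv.
    assert (Hs : Cmod (u - x, v - y) <= L / 2 ^ n).
    { eapply Rle_trans. apply Cmod_pair_le. specialize (Hx n). specialize (Hy n).
      replace (L / 2 ^ n) with ((B n - A n) + (D n - C n)).
      2:{ unfold L. destruct I1 as (_ & _ & ->). destruct I2 as (_ & _ & ->). field. apply Rgt_not_eq, P2. }
      apply Rplus_le_compat; apply Rabs_le; lra. }
    specialize (Hest (u - x, v - y)).
    replace ((x, y) + ((u - x)%R, (v - y)%R))%C with (u, v) in Hest
      by (apply injective_projections; simpl; ring).
    replace (F (u, v) - T (u, v))%C with (F (u, v) - F (x, y) - l * ((u - x)%R, (v - y)%R))%C.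
    2:{ unfold T. replace (u - x, v - y) with ((u, v) - (x, y))%C by reflexivity. ring. }
    eapply Rle_trans. apply Hest. lra. apply Rmult_le_compat_l; lra.
  - right. f_equal. destruct I1 as (_ & _ & ->). destruct I2 as (_ & _ & ->).
    unfold L. field. apply Rgt_not_eq, P2. }
assert (Q : Cmod (boundary_int F a b c d) <= 2 * eps * L ^ 2).
{ assert (E4 : 4 ^ n = 2 ^ n * 2 ^ n) by (rewrite <- Rpow_mult_distr; f_equal; lra).
  specialize (P2 n).
  replace (Cmod (boundary_int F a b c d)) with (Cmod (boundary_int F a b c d) / 4 ^ n * 4 ^ n)
   by (rewrite E4; field; lra).
  replace (2 * eps * L ^ 2) with (2 * (eps * (L / 2 ^ n)) * (L / 2 ^ n) * 4 ^ n)
   by (rewrite E4; field; lra).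
  apply Rmult_le_compat_r. rewrite E4. nra. lra. }
unfold eps in Q.
replace (2 * (Cmod (boundary_int F a b c d) / (2 * (L ^ 2 + 1))) * L ^ 2) with
 (Cmod (boundary_int F a b c d) - Cmod (boundary_int F a b c d) / (L ^ 2 + 1)) in Q by (field; nra).
assert (0 < Cmod (boundary_int F a b c d) / (L ^ 2 + 1)) by (apply Rdiv_lt_0_compat; nra).
lra.
Qed.

(** * The complex exponential *)

Definition cexp (z : C) : C := (RtoC (exp (Re z)) * (cos (Im z), sin (Im z)))%C.

Lemma cexp_add z w : cexp (z + w) = (cexp z * cexp w)%C.
Proof.
destruct z as [x y], w as [u v]. unfold cexp; simpl. rewrite exp_plus, cos_plus, sin_plus.
apply injective_projections; simpl; ring.
Qed.

Lemma cexp_0 : cexp 0 = 1.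
Proof.
unfold cexp; simpl. rewrite exp_0, cos_0, sin_0. apply injective_projections; simpl; ring.
Qed.

Lemma cexp_opp_l z : (cexp (- z) * cexp z)%C = 1.
Proof. rewrite <- cexp_add, <- cexp_0. f_equal. ring. Qed.

Lemma Cmod_cis (y : R) : Cmod (cos y, sin y) = 1.
Proof.
unfold Cmod; simpl. replace (_ + _) with (Rsqr (sin y) + Rsqr (cos y)) by (unfold Rsqr; ring).
rewrite sin2_cos2. apply sqrt_1.
Qed.

Lemma Cmod_cexp z : Cmod (cexp z) = exp (Re z).
Proof.
unfold cexp. rewrite Cmod_mult, Cmod_cis, Cmod_R, Rabs_pos_eq. ring.
apply Rlt_le, exp_pos.
Qed.

Lemma cexp_period (x y : R) : cexp (x, y + 2 * PI) = cexp (x, y).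
Proof. unfold cexp; simpl. now rewrite cos_plus, sin_plus, cos_2PI, sin_2PI, !Rmult_1_r, !Rmult_0_r, Rminus_0_r, Rplus_0_r. Qed.

Lemma real_deriv_o (f : R -> R) l eps : is_derive f 0 l -> 0 < eps ->
  exists d, 0 < d /\ forall h, Rabs h < d -> Rabs (f h - f 0 - l * h) <= eps * Rabs h.
Proof.
intros H He. apply is_derive_Reals in H. destruct (H eps He) as [d Hd].
exists d. split. apply cond_pos. intros h Hh. destruct (Req_dec h 0) as [->|Hn].
- replace (_ - _) with 0 by ring. rewrite Rabs_R0. lra.
- specialize (Hd h Hn Hh). rewrite Rplus_0_l in Hd.
  replace (f h - f 0 - l * h) with (((f h - f 0) / h - l) * h) by (now field).
  rewrite Rabs_mult. apply Rmult_le_compat_r. apply Rabs_pos. lra.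
Qed.

Lemma Rabs_Re_le z : Rabs (Re z) <= Cmod z.
Proof. eapply Rle_trans. 2: apply Rmax_Cmod. apply Rmax_l. Qed.

Lemma Rabs_Im_le z : Rabs (Im z) <= Cmod z.
Proof. eapply Rle_trans. 2: apply Rmax_Cmod. apply Rmax_r. Qed.

Lemma cexp_diff_0 eps : 0 < eps -> exists d, 0 < d /\
  forall h, Cmod h < d -> Cmod (cexp h - 1 - h)%C <= eps * Cmod h.
Proof.
(* With cis y = (cos y, sin y) and N the modulus of h = (x, y), the remainder splits as (e^x-1-x)
   cis y + x(cis y - 1) + (cis y - 1 - iy), of sizes at most eN, 2eN and 2eN in terms of the
   constant [e]: five shares of eps/5. The cap 1/5 gives 2e <= 1, which absorbs the quadratic middle
   term. *)
intros He. set (e := Rmin (eps / 5) (1 / 5)).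
assert (He' : 0 < e) by (apply Rmin_pos; lra).
assert (e <= eps / 5) by apply Rmin_l. assert (e <= 1 / 5) by apply Rmin_r.
destruct (real_deriv_o exp 1 e) as (d1 & D1 & H1); auto.
{ auto_derive; auto. rewrite exp_0. ring. }
destruct (real_deriv_o cos 0 e) as (d2 & D2 & H2); auto.
{ auto_derive; auto. rewrite sin_0. ring. }
destruct (real_deriv_o sin 1 e) as (d3 & D3 & H3); auto.
{ auto_derive; auto. rewrite cos_0. ring. }
rewrite exp_0 in H1. rewrite cos_0 in H2. rewrite sin_0 in H3.
set (d := Rmin (Rmin d1 d2) (Rmin d3 e)).
assert (d <= d1 /\ d <= d2 /\ d <= d3 /\ d <= e) as (E1 & E2 & E3 & E4).
{ unfold d. pose proof (Rmin_l d1 d2). pose proof (Rmin_r d1 d2).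
  pose proof (Rmin_l d3 e). pose proof (Rmin_r d3 e).
  pose proof (Rmin_l (Rmin d1 d2) (Rmin d3 e)). pose proof (Rmin_r (Rmin d1 d2) (Rmin d3 e)). lra. }
exists d. split. { unfold d. repeat apply Rmin_pos; auto; lra. }
intros [x y] Hh. pose proof (Rabs_Re_le (x, y)) as Hx. pose proof (Rabs_Im_le (x, y)) as Hy.
simpl in Hx, Hy. set (N := Cmod (x, y)) in *.
specialize (H1 x ltac:(lra)). specialize (H2 y ltac:(lra)). specialize (H3 y ltac:(lra)).
assert (HN : 0 <= N) by apply Cmod_ge_0.
assert (T1 : Cmod (RtoC (exp x - 1 - 1 * x) * (cos y, sin y))%C <= e * N).
{ rewrite Cmod_mult, Cmod_cis, Cmod_R. nra. }
assert (T3 : Cmod ((cos y - 1 - 0 * y)%R, (sin y - 0 - 1 * y)%R) <= 2 * e * N).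
{ eapply Rle_trans. apply Cmod_pair_le. nra. }
assert (T2 : Cmod (RtoC x * (((cos y - 1 - 0 * y)%R, (sin y - 0 - 1 * y)%R) + Ci * RtoC y))%C <= 2 * e * N).
{ rewrite Cmod_mult, Cmod_R.
  assert (Cmod (((cos y - 1 - 0 * y)%R, (sin y - 0 - 1 * y)%R) + Ci * RtoC y) <= 2 * e * N + N).
  { eapply Rle_trans. apply Cmod_triangle. rewrite Cmod_mult, Cmod_Ci, Cmod_R. lra. }
  pose proof (Cmod_ge_0 (((cos y - 1 - 0 * y)%R, (sin y - 0 - 1 * y)%R) + Ci * RtoC y)).
  apply Rle_trans with (N * (2 * e * N + N)).
  - apply Rmult_le_compat; auto. apply Rabs_pos.
  - assert (N <= e) by lra. assert (N * N <= e * N) by nra. nra. }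
replace (cexp (x, y) - 1 - (x, y))%C with
  (RtoC (exp x - 1 - 1 * x) * (cos y, sin y)
   + (RtoC x * (((cos y - 1 - 0 * y)%R, (sin y - 0 - 1 * y)%R) + Ci * RtoC y)
   + ((cos y - 1 - 0 * y)%R, (sin y - 0 - 1 * y)%R)))%C.
2:{ unfold cexp; simpl. apply injective_projections; simpl; ring. }
eapply Rle_trans. apply Cmod_triangle.
eapply Rle_trans. apply Rplus_le_compat_l, Cmod_triangle. nra.
Qed.

Lemma Cdiff_cexp z : Cdiff cexp z.
Proof.
exists (cexp z). intros eps He.
destruct (cexp_diff_0 (eps / exp (Re z))) as (d & Hd & H).
{ apply Rdiv_lt_0_compat; auto. apply exp_pos. }
exists d. split; auto. intros h Hh. rewrite cexp_add.
replace (_ - _ - _)%C with (cexp z * (cexp h - 1 - h))%C by ring.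
rewrite Cmod_mult, Cmod_cexp. specialize (H h Hh).
pose proof (exp_pos (Re z)).
replace (eps * Cmod h) with (exp (Re z) * (eps / exp (Re z) * Cmod h)) by (field; lra).
apply Rmult_le_compat_l; lra.
Qed.

Lemma Cdiff_comp f g z : Cdiff f (g z) -> Cdiff g z -> Cdiff (fun z => f (g z)) z.
Proof.
intros [l Hl] Hg. destruct (Cdiff_lip _ _ Hg) as (K & d0 & HK & Hd0 & HK').
destruct Hg as [k Hk]. exists (l * k)%C. intros eps He.
pose proof (Cmod_ge_0 l).
destruct (Hl (eps / (2 * K))) as (d1 & Hd1 & H1). apply Rdiv_lt_0_compat; lra.
destruct (Hk (eps / (2 * (Cmod l + 1)))) as (d2 & Hd2 & H2). apply Rdiv_lt_0_compat; lra.
exists (Rmin d0 (Rmin (d1 / K) d2)). split.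
{ repeat apply Rmin_pos; auto. apply Rdiv_lt_0_compat; lra. }
intros h Hh. pose proof (Rmin_l d0 (Rmin (d1 / K) d2)). pose proof (Rmin_r d0 (Rmin (d1 / K) d2)).
pose proof (Rmin_l (d1 / K) d2). pose proof (Rmin_r (d1 / K) d2).
assert (Hh1 : Cmod (g (z + h)%C - g z) <= K * Cmod h) by (apply HK'; lra).
assert (Hh2 : K * Cmod h < d1).
{ apply Rlt_le_trans with (K * (d1 / K)). apply Rmult_lt_compat_l; lra. right. field. lra. }
specialize (H1 (g (z + h)%C - g z)%C ltac:(lra)).
replace (g z + (g (z + h)%C - g z))%C with (g (z + h)%C) in H1 by ring.
specialize (H2 h ltac:(lra)).
replace (_ - _ - _)%C with
 ((f (g (z + h)%C) - f (g z) - l * (g (z + h)%C - g z)) + l * (g (z + h)%C - g z - k * h))%C by ring.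
eapply Rle_trans. apply Cmod_triangle. rewrite Cmod_mult.
pose proof (Cmod_ge_0 h).
assert (A : eps / (2 * K) * Cmod (g (z + h)%C - g z) <= eps / 2 * Cmod h).
{ replace (eps / 2 * Cmod h) with (eps / (2 * K) * (K * Cmod h)) by (field; lra).
  apply Rmult_le_compat_l; auto. apply Rlt_le, Rdiv_lt_0_compat; lra. }
assert (B : Cmod l * Cmod (g (z + h)%C - g z - k * h) <= eps / 2 * Cmod h).
{ apply Rle_trans with ((Cmod l + 1) * (eps / (2 * (Cmod l + 1)) * Cmod h)).
  apply Rmult_le_compat; try lra. apply Cmod_ge_0. right. field. lra. }
lra.
Qed.

Lemma Cdiff_mult f g z : Cdiff f z -> Cdiff g z -> Cdiff (fun z => f z * g z)%C z.
Proof.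
intros Hf Hg.
destruct (Cdiff_lip _ _ Hf) as (K & d1 & HK & Hd1 & H1).
destruct (Cdiff_lip _ _ Hg) as (L & d2 & HL & Hd2 & H2).
destruct Hf as [l Hl]. destruct Hg as [k Hk].
exists (l * g z + f z * k)%C. intros eps He.
pose proof (Cmod_ge_0 (f z)). pose proof (Cmod_ge_0 (g z)).
destruct (Hl (eps / (3 * (Cmod (g z) + 1)))) as (d3 & Hd3 & H3). apply Rdiv_lt_0_compat; lra.
destruct (Hk (eps / (3 * (Cmod (f z) + 1)))) as (d4 & Hd4 & H4). apply Rdiv_lt_0_compat; lra.
(* Radius on which the cross term K L |h|^2 of the two increments is at most (eps/3)|h|. *)
set (d5 := eps / (3 * K * L)).
assert (Hd5 : 0 < d5) by (apply Rdiv_lt_0_compat; nra).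
exists (Rmin (Rmin d1 d2) (Rmin (Rmin d3 d4) d5)). split.
{ repeat apply Rmin_pos; auto. }
intros h Hh.
pose proof (Rmin_l d1 d2). pose proof (Rmin_r d1 d2).
pose proof (Rmin_l d3 d4). pose proof (Rmin_r d3 d4).
pose proof (Rmin_l (Rmin d3 d4) d5). pose proof (Rmin_r (Rmin d3 d4) d5).
pose proof (Rmin_l (Rmin d1 d2) (Rmin (Rmin d3 d4) d5)).
pose proof (Rmin_r (Rmin d1 d2) (Rmin (Rmin d3 d4) d5)).
specialize (H1 h ltac:(lra)). specialize (H2 h ltac:(lra)).
specialize (H3 h ltac:(lra)). specialize (H4 h ltac:(lra)).
replace (_ - _ - _)%C with
 (((f (z + h)%C - f z - l * h) * g z + f z * (g (z + h)%C - g z - k * h))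
  + (f (z + h)%C - f z) * (g (z + h)%C - g z))%C by ring.
eapply Rle_trans. apply Cmod_triangle.
eapply Rle_trans. apply Rplus_le_compat_r, Cmod_triangle. rewrite !Cmod_mult.
pose proof (Cmod_ge_0 h).
assert (A : Cmod (f (z + h)%C - f z - l * h) * Cmod (g z) <= eps / 3 * Cmod h).
{ apply Rle_trans with ((eps / (3 * (Cmod (g z) + 1)) * Cmod h) * (Cmod (g z) + 1)).
  apply Rmult_le_compat; try lra. apply Cmod_ge_0. right. field. lra. }
assert (B : Cmod (f z) * Cmod (g (z + h)%C - g z - k * h) <= eps / 3 * Cmod h).
{ apply Rle_trans with ((Cmod (f z) + 1) * (eps / (3 * (Cmod (f z) + 1)) * Cmod h)).
  apply Rmult_le_compat; try lra. apply Cmod_ge_0. right. field. lra. }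
assert (D : Cmod (f (z + h)%C - f z) * Cmod (g (z + h)%C - g z) <= eps / 3 * Cmod h).
{ apply Rle_trans with ((K * Cmod h) * (L * Cmod h)).
  apply Rmult_le_compat; try lra; apply Cmod_ge_0.
  apply Rle_trans with ((K * L * Cmod h) * d5).
  replace (K * Cmod h * (L * Cmod h)) with (K * L * Cmod h * Cmod h) by ring.
  apply Rmult_le_compat_l. apply Rmult_le_pos; nra. lra.
  right. unfold d5. field. lra. }
lra.
Qed.

Lemma Cdiff_ext f g z : (forall z, f z = g z) -> Cdiff f z -> Cdiff g z.
Proof.
intros E [l H]. exists l. intros eps He. destruct (H eps He) as (d & Hd & H').
exists d. split; auto. intros h Hh. rewrite <- !E. auto.
Qed.

Lemma Cdiff_const c z : Cdiff (fun _ => c) z.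
Proof. apply Cdiff_ext with (2 := Cdiff_affine c 0 z). intros; ring. Qed.

Lemma Cdiff_opp z : Cdiff (fun z => - z)%C z.
Proof. apply Cdiff_ext with (2 := Cdiff_affine 0 (-(1)) z). intros; ring. Qed.

Lemma Cdiff_pow f n z : Cdiff f z -> Cdiff (fun z => f z ^ n)%C z.
Proof.
intros H. induction n as [|n IH].
- exact (Cdiff_const (RtoC 1) z).
- apply (Cdiff_mult f (fun z => f z ^ n)%C); auto.
Qed.

Lemma Cdiff_cexp_opp z : Cdiff (fun z => cexp (- z)) z.
Proof. apply (Cdiff_comp cexp Copp). apply Cdiff_cexp. apply Cdiff_opp. Qed.

Lemma ex_derive_Cdiff (f : C -> C) z :
  ex_derive (K := C_AbsRing) (V := C_NormedModule) f z -> Cdiff f z.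
Proof.
intros [l Hl]. exists l. intros eps He.
destruct Hl as [_ Hl]. specialize (Hl z (fun P H => H) (mkposreal eps He)).
destruct Hl as [d Hd]. exists d. split. apply cond_pos.
intros h Hh. specialize (Hd (z + h)%C).
assert (Hb : ball (M := AbsRing_UniformSpace C_AbsRing) z d (z + h)%C).
{ unfold ball; simpl. unfold AbsRing_ball, abs, minus, plus, opp; simpl.
  replace (z + h + - z)%C with h by ring. exact Hh. }
specialize (Hd Hb).
unfold norm, minus, plus, opp, scal in Hd; simpl in Hd. unfold mult, abs in Hd; simpl in Hd.
replace (z + h + - z)%C with h in Hd by ring.
replace (f (z + h)%C - f z - l * h)%C with (f (z + h)%C + - f z + - (h * l))%C by ring. exact Hd.
Qed.

(** * Fourier coefficients on vertical periods *)

(** [2 pi i]-periodic functions holomorphic on the left half-plane are, through [cexp],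
    the holomorphic functions on the punctured disk; [0] sits at [Re z = -oo]. *)
Definition periodic_holomorphic (F : C -> C) : Prop :=
  (forall z, Re z < 0 -> Cdiff F z) /\ (forall x y : R, F (x, y + 2 * PI) = F (x, y)).

Definition vint (F : C -> C) (s : R) : C := CInt (fun y => F (s, y)) 0 (2 * PI).

Lemma two_PI_pos : 0 < 2 * PI.
Proof. pose proof PI_RGT_0. lra. Qed.

Lemma periodic_holomorphic_mult F G : periodic_holomorphic F -> periodic_holomorphic G ->
  periodic_holomorphic (fun z => F z * G z)%C.
Proof.
intros [H1 P1] [H2 P2]. split.
- intros z Hz. apply Cdiff_mult; auto.
- intros x y. now rewrite P1, P2.
Qed.

Lemma periodic_holomorphic_pow F n : periodic_holomorphic F -> periodic_holomorphic (fun z => F z ^ n)%C.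
Proof.
intros [H1 P1]. split.
- intros z Hz. apply Cdiff_pow; auto.
- intros x y. now rewrite P1.
Qed.

Lemma periodic_holomorphic_const c : periodic_holomorphic (fun _ => c).
Proof. split; intros; auto. apply Cdiff_const. Qed.

Lemma periodic_holomorphic_cexp : periodic_holomorphic cexp.
Proof. split. intros; apply Cdiff_cexp. apply cexp_period. Qed.

Lemma periodic_holomorphic_cexp_opp : periodic_holomorphic (fun z => cexp (- z)).
Proof.
split. intros; apply Cdiff_cexp_opp.
intros x y. unfold cexp; simpl.
now rewrite !cos_neg, !sin_neg, cos_plus, sin_plus, cos_2PI, sin_2PI, !Rmult_1_r, !Rmult_0_r, Rminus_0_r, Rplus_0_r.
Qed.

Lemma periodic_holomorphic_integrable F s : periodic_holomorphic F -> s < 0 ->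
  Cintegrable (fun y => F (s, y)) 0 (2 * PI).
Proof.
intros [H _] Hs. pose proof two_PI_pos. apply (Cintegrable_vertical F s s 0 (2 * PI)); try lra.
intros x y Hx _. apply H. simpl. lra.
Qed.

(** Cauchy's theorem for an annulus: on the rectangle over one period the horizontal sides cancel by
    periodicity, so Goursat's lemma leaves [Ci] times the difference of the two vertical
    integrals. *)
Lemma vint_const F s t : periodic_holomorphic F -> s < 0 -> t < 0 -> vint F s = vint F t.
Proof.
intros HF. revert s t.
assert (H : forall s t, s <= t -> t < 0 -> vint F s = vint F t).
{ intros s t Hst Ht. pose proof two_PI_pos.
  assert (G : boundary_int F s t 0 (2 * PI) = 0).
  { apply goursat_rectangle; try lra. intros x y Hx _. apply HF. simpl. lra. }
  unfold boundary_int in G.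
  rewrite (CInt_ext (fun x => F (x, 2 * PI)) (fun x => F (x, 0))) in G; auto.
  2:{ intros x _. rewrite <- (Rplus_0_l (2 * PI)). apply HF. }
  fold (vint F s) (vint F t) in G.
  assert (E : (vint F t - vint F s)%C = 0).
  { replace (vint F t - vint F s)%C with (- Ci * (Ci * (vint F t - vint F s)))%C.
    - replace (Ci * (vint F t - vint F s))%C with (RtoC 0). ring. rewrite <- G. ring.
    - apply injective_projections; simpl; ring. }
  symmetry. now apply Ceq_minus. }
intros s t Hs Ht. destruct (Rle_dec s t). now apply H. symmetry. apply H; lra.
Qed.

Lemma Cmod_zero_of_small z (M : R) : (forall eps, 0 < eps -> Cmod z <= M * eps) -> z = 0.
Proof.
intros H. apply Cmod_eq_0. pose proof (Cmod_ge_0 z).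
apply Rle_antisym; auto. apply Rnot_lt_le. intros Hp.
assert (0 < M). { specialize (H 1 Rlt_0_1). lra. }
specialize (H (Cmod z / (2 * M)) ltac:(apply Rdiv_lt_0_compat; lra)).
replace (M * (Cmod z / (2 * M))) with (Cmod z / 2) in H by (field; lra). lra.
Qed.

(** The integral is, up to 2 pi, the coefficient of index [- l]. Moving the line to the far left,
    where [V] stays bounded while the power of [cexp] decays, forces it to be 0; this is the
    removable singularity at the centre of the disk. *)
Lemma vint_cexp_pow_zero V K s0 l s : periodic_holomorphic V -> s0 < 0 ->
  (forall x y : R, x <= s0 -> Cmod (V (x, y)) <= K) -> (1 <= l)%nat -> s < 0 ->
  vint (fun z => V z * cexp z ^ l)%C s = 0.
Proof.
intros HV Hs0 HK Hl Hs. pose proof two_PI_pos.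
assert (HF : periodic_holomorphic (fun z => V z * cexp z ^ l)%C).
{ apply periodic_holomorphic_mult; auto.
  apply (periodic_holomorphic_pow cexp), periodic_holomorphic_cexp. }
apply Cmod_zero_of_small with (M := K * (2 * PI)). intros eps He.
(* Left of [s0] the bound [K] applies; left of [ln eps] one factor [exp t] is at most [eps], the
   remaining factors being at most 1. *)
set (t := Rmin s0 (ln eps)).
assert (Ht : t <= s0) by apply Rmin_l. assert (Ht' : t <= ln eps) by apply Rmin_r.
rewrite (vint_const _ s t) by (auto; lra).
assert (HK0 : 0 <= K). { eapply Rle_trans. 2: apply (HK t 0 Ht). apply Cmod_ge_0. }
replace (K * (2 * PI) * eps) with (K * eps * (2 * PI - 0)) by ring.
apply CInt_bound. lra. apply (periodic_holomorphic_integrable _ t HF). lra.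
intros y _. rewrite Cmod_mult, Cmod_pow, Cmod_cexp. simpl.
pose proof (exp_pos t).
apply Rmult_le_compat; auto. apply Cmod_ge_0. apply pow_le; lra.
destruct l as [|l]. lia. simpl.
assert (exp t <= 1). { rewrite <- exp_0. apply Rlt_le, exp_increasing. lra. }
assert (exp t <= eps). { rewrite <- (exp_ln eps) by auto. destruct Ht'. now apply Rlt_le, exp_increasing. right. now f_equal. }
assert (exp t ^ l <= 1). { rewrite <- (pow1 l). apply pow_incr. lra. }
assert (0 <= exp t ^ l) by (apply pow_le; lra). nra.
Qed.

Lemma unimodular_rotation z : exists u, Cmod u = 1 /\ (u * z)%C = RtoC (Cmod z).
Proof.
destruct (Ceq_dec z 0) as [->|Hz].
- exists 1. rewrite Cmod_1, Cmod_0. split; auto. ring.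
- assert (Hp : 0 < Cmod z) by now apply Cmod_gt_0.
  assert (Hn : RtoC (Cmod z) <> 0) by (intros E; apply RtoC_inj in E; lra).
  exists (Cconj z / RtoC (Cmod z))%C. split.
  + rewrite Cmod_div, Cmod_conj, Cmod_R, Rabs_pos_eq by (auto; lra). field. lra.
  + replace (Cconj z / RtoC (Cmod z) * z)%C with ((z * Cconj z) / RtoC (Cmod z))%C by (field; auto).
    rewrite <- Cmod2_conj. simpl. rewrite !RtoC_mult. field. auto.
Qed.

(** Positivity of [B - Re (u phi)], where the unimodular [u] makes the integral of [u phi]
    nonnegative, bounds its Fourier coefficients by its mean. *)
Lemma fourier_coefficient_bound (phi e : R -> C) (B a b : R) : a <= b ->
  Cintegrable phi a b -> Cintegrable e a b -> Cintegrable (fun t => phi t * e t)%C a b ->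
  Cintegrable (fun t => phi t * Cconj (e t))%C a b ->
  (forall t, a <= t <= b -> Cmod (phi t) <= B) -> (forall t, a <= t <= b -> Cmod (e t) <= 1) ->
  CInt (fun t => phi t * e t)%C a b = 0 -> CInt e a b = 0 ->
  Cmod (CInt (fun t => phi t * Cconj (e t))%C a b) <= 2 * (B * (b - a) - Cmod (CInt phi a b)).
Proof.
intros Hab Hphi He Hpe Hpc HB H1 Z1 Z2.
destruct (unimodular_rotation (CInt phi a b)) as (u & Hu & Hrot).
apply CInt_correct in Hphi, He, Hpe, Hpc. rewrite Z1 in Hpe. rewrite Z2 in He.
set (J := CInt (fun t => phi t * Cconj (e t))%C a b) in *.
(* [I4] integrates conj(e) times 2(B - Re(u phi)), written as 2B conj(e) - u phi conj(e) - conj(u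
   phi e). The first and last terms integrate to 0 by [Z2] and [Z1], leaving - u J. [I6] integrates
   the dominating weight 2(B - Re(u phi)) itself, where the choice of [u] produces the modulus of
   the mean. *)
pose proof (is_CInt_scal (RtoC (2 * B)) _ a b _ (is_CInt_conj _ a b _ He)) as I1.
pose proof (is_CInt_scal u _ a b _ Hpc) as I2.
pose proof (is_CInt_conj _ a b _ (is_CInt_scal u _ a b _ Hpe)) as I3.
pose proof (is_RInt_minus (V := C_R_NormedModule) _ _ a b _ _ I1
  (is_RInt_plus (V := C_R_NormedModule) _ _ a b _ _ I2 I3)) as I4.
pose proof (proj1 (proj1 (is_CInt_pair _ a b _) (is_CInt_scal u _ a b _ Hphi))) as I5.
rewrite Hrot in I5. simpl in I5.
pose proof (is_RInt_scal _ a b 2 _ (is_RInt_minus _ _ a b _ _ (is_RInt_const a b B) I5)) as I6.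
pose proof (fun H => norm_RInt_le (V := C_R_NormedModule) _ _ a b _ _ Hab H I4 I6) as N.
rewrite norm_C_R in N.
replace (Cmod J) with
 (Cmod (minus (RtoC (2 * B) * Cconj 0)%C (plus (u * J)%C (Cconj (u * 0))))).
2:{ change (Cmod (RtoC (2 * B) * Cconj 0 - (u * J + Cconj (u * 0)))%C = Cmod J).
  replace (RtoC (2 * B) * Cconj 0 - (u * J + Cconj (u * 0)))%C with (- (u * J))%C.
  - rewrite Cmod_opp, Cmod_mult, Hu. ring.
  - apply injective_projections; simpl; ring. }
eapply Rle_trans. apply N.
- intros t Ht. rewrite norm_C_R.
  change (Cmod (RtoC (2 * B) * Cconj (e t)
    - (u * (phi t * Cconj (e t)) + Cconj (u * (phi t * e t))))%C <= 2 * (B - Re (u * phi t))).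
  replace (_ - _)%C with (Cconj (e t) * RtoC (2 * (B - Re (u * phi t))))%C.
  2:{ apply injective_projections; unfold Re; simpl; ring. }
  rewrite Cmod_mult, Cmod_conj, Cmod_R.
  assert (Re (u * phi t) <= B).
  { eapply Rle_trans. apply Rle_abs. eapply Rle_trans. apply Rabs_Re_le.
    rewrite Cmod_mult, Hu. specialize (HB t Ht). lra. }
  rewrite Rabs_pos_eq by lra. specialize (H1 t Ht). nra.
- right. change (2 * ((b - a) * B - Cmod (CInt phi a b)) = 2 * (B * (b - a) - Cmod (CInt phi a b))). ring.
Qed.

(** For the pullback [V] of a function on the disk this is 2 pi times its [l]-th Taylor coefficient;
    the division by 2 pi is postponed to the final comparison. The abscissa [s] stays as a
    parameter, to be moved by [vint_const]. *)
Definition fourier (V : C -> C) (l : nat) (s : R) : C := vint (fun z => V z * cexp (- z) ^ l)%C s.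

Lemma periodic_holomorphic_fourier V l : periodic_holomorphic V ->
  periodic_holomorphic (fun z => V z * cexp (- z) ^ l)%C.
Proof.
intros H. apply periodic_holomorphic_mult; auto.
apply (periodic_holomorphic_pow (fun z => cexp (- z))), periodic_holomorphic_cexp_opp.
Qed.

(** This is 1/zeta = conj(zeta)/|zeta|^2 with |zeta| = exp s. On one line it turns the weight of
    [fourier] into a multiple of the conjugate of the weight in [vint_cexp_pow_zero]. *)
Lemma cexp_opp_conj (s y : R) : cexp (- (s, y)) = (RtoC (exp (- (2 * s))) * Cconj (cexp (s, y)))%C.
Proof.
replace (- (2 * s)) with (- s + - s) by ring. rewrite exp_plus.
assert (E : exp (- s) * exp s = 1) by (rewrite <- exp_plus, Rplus_opp_l; apply exp_0).
unfold cexp; simpl. rewrite cos_neg, sin_neg.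
apply injective_projections; simpl.
- replace (_ - _) with (exp (- s) * cos y) by ring.
  replace (_ - _) with (exp (- s) * cos y * (exp (- s) * exp s)) by ring. rewrite E. ring.
- replace (_ + _) with (- (exp (- s) * sin y)) by ring.
  replace (_ + _) with (- (exp (- s) * sin y) * (exp (- s) * exp s)) by ring. rewrite E. ring.
Qed.

Lemma fourier_zero V s : fourier V 0 s = vint V s.
Proof.
unfold fourier, vint. pose proof two_PI_pos. apply CInt_ext. lra. intros t _. simpl. ring.
Qed.

(** An instance of [fourier_coefficient_bound] in which [e] is the [l]-th power of [cexp],
    normalised on the line. Both vanishing conditions come from [vint_cexp_pow_zero], applied to [V]
    and to the constant 1. *)
Lemma fourier_bound_line V K s0 l s B : periodic_holomorphic V -> s0 < 0 ->
  (forall x y : R, x <= s0 -> Cmod (V (x, y)) <= K) -> (1 <= l)%nat -> s < 0 ->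
  (forall y, Cmod (V (s, y)) <= B) ->
  exp s ^ l * Cmod (fourier V l s) <= 2 * (B * (2 * PI) - Cmod (fourier V 0 s)).
Proof.
intros HV Hs0 HK Hl Hs HB. pose proof two_PI_pos.
assert (Hc : periodic_holomorphic (fun z => cexp z ^ l)%C)
 by (apply (periodic_holomorphic_pow cexp), periodic_holomorphic_cexp).
pose proof (periodic_holomorphic_integrable _ s HV Hs) as I0.
pose proof (periodic_holomorphic_integrable _ s Hc Hs) as I1.
pose proof (periodic_holomorphic_integrable _ s (periodic_holomorphic_mult _ _ HV Hc) Hs) as I2.
pose proof (periodic_holomorphic_integrable _ s (periodic_holomorphic_fourier V l HV) Hs) as I3.
simpl in I1, I2, I3.
assert (Z1 := vint_cexp_pow_zero V K s0 l s HV Hs0 HK Hl Hs).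
assert (Z2 : vint (fun z => cexp z ^ l)%C s = 0).
{ rewrite <- (vint_cexp_pow_zero (fun _ => RtoC 1) 1 s0 l s); auto.
  - unfold vint. apply CInt_ext. lra. intros; ring.
  - apply periodic_holomorphic_const.
  - intros. rewrite Cmod_1. lra. }
(* The factor [k ^ l] gives [cexp (s, t) ^ l] modulus 1; conjugated, the product is [exp s ^ l]
   times the weight of [fourier], the source of the factor on the left of the claim. *)
set (k := exp (- s)). assert (Hk : 0 < k) by apply exp_pos.
assert (Ek : k * exp s = 1) by (unfold k; rewrite <- exp_plus, Rplus_opp_l; apply exp_0).
assert (E : forall t, Cconj (RtoC (k ^ l) * cexp (s, t) ^ l) = (RtoC (exp s ^ l) * cexp (- (s, t)) ^ l)%C).
{ intros t. rewrite Cmult_conj, Cpow_conj, cexp_opp_conj, Cpow_mult_l, <- RtoC_pow.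
  rewrite Cmult_assoc, <- RtoC_mult, <- Rpow_mult_distr.
  replace (exp s * exp (- (2 * s))) with k. 2:{ unfold k. rewrite <- exp_plus. f_equal. ring. }
  f_equal. apply injective_projections; simpl; ring. }
pose proof (fourier_coefficient_bound (fun y => V (s, y)) (fun y => RtoC (k ^ l) * cexp (s, y) ^ l)%C
  B 0 (2 * PI)) as F.
rewrite Rminus_0_r in F. rewrite fourier_zero. unfold vint at 1.
replace (exp s ^ l * Cmod (fourier V l s)) with
 (Cmod (CInt (fun t => V (s, t) * Cconj (RtoC (k ^ l) * cexp (s, t) ^ l)) 0 (2 * PI))%C).
2:{ rewrite (CInt_ext _ (fun t => RtoC (exp s ^ l) * (V (s, t) * cexp (- (s, t)) ^ l))%C) by
     (try lra; intros; rewrite E; ring).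
  rewrite CInt_scal by exact I3. rewrite Cmod_mult, Cmod_R, Rabs_pos_eq. reflexivity.
  apply pow_le, Rlt_le, exp_pos. }
apply F; auto.
- lra.
- apply Cintegrable_scal. exact I1.
- apply Cintegrable_ext with (fun t => RtoC (k ^ l) * (V (s, t) * cexp (s, t) ^ l))%C.
  intros t; ring. apply Cintegrable_scal. exact I2.
- apply Cintegrable_ext with (fun t => RtoC (exp s ^ l) * (V (s, t) * cexp (- (s, t)) ^ l))%C.
  intros t; rewrite E; ring. apply Cintegrable_scal. exact I3.
- intros t _. rewrite Cmod_mult, Cmod_R, Cmod_pow, Cmod_cexp. simpl.
  rewrite Rabs_pos_eq by (apply pow_le; lra). rewrite <- Rpow_mult_distr, Ek, pow1. lra.
- rewrite (CInt_ext _ (fun t => RtoC (k ^ l) * (V (s, t) * cexp (s, t) ^ l))%C) by (try lra; intros; ring).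
  rewrite CInt_scal by exact I2. unfold vint in Z1. rewrite Z1. ring.
- rewrite CInt_scal by exact I1. unfold vint in Z2. rewrite Z2. ring.
Qed.

(** [s -> 0] in [fourier_bound_line]. *)
Lemma fourier_bound V K s0 l s m : periodic_holomorphic V -> s0 < 0 ->
  (forall x y : R, x <= s0 -> Cmod (V (x, y)) <= K) -> (1 <= l)%nat -> s < 0 ->
  (forall x y : R, x < 0 -> Cmod (V (x, y)) <= exp (- x) ^ m) ->
  Cmod (fourier V l s) <= 2 * (2 * PI - Cmod (fourier V 0 s)).
Proof.
intros HV Hs0 HK Hl Hs HB.
assert (H : forall x, x < 0 -> exp x ^ l * Cmod (fourier V l s) <=
  2 * (exp (- x) ^ m * (2 * PI) - Cmod (fourier V 0 s))).
{ intros x Hx.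
  rewrite (vint_const _ s x (periodic_holomorphic_fourier V l HV) Hs Hx : fourier V l s = fourier V l x).
  rewrite (vint_const _ s x (periodic_holomorphic_fourier V 0 HV) Hs Hx : fourier V 0 s = fourier V 0 x).
  apply (fourier_bound_line V K s0); auto. }
apply Rnot_lt_le. intros Hc.
(* [H] makes [gap] nonpositive at every negative abscissa, while the negated claim makes it positive
   at 0; continuity at 0 is contradicted at the point [- d / 2]. *)
set (gap := fun x => exp x ^ l * Cmod (fourier V l s)
  - 2 * (exp (- x) ^ m * (2 * PI) - Cmod (fourier V 0 s))).
assert (G0 : 0 < gap 0).
{ unfold gap. rewrite Ropp_0, exp_0, !pow1. lra. }
assert (Hcont : continuity_pt gap 0).
{ apply derivable_continuous_pt. unfold gap. reg. }
destruct (Hcont (gap 0) G0) as (d & Hd & Hd').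
specialize (Hd' (- d / 2)).
assert (Hr : Rabs (gap (- d / 2) - gap 0) < gap 0).
{ apply Hd'. split. split; [exact I | lra]. simpl. unfold R_dist. rewrite Rminus_0_r, Rabs_left; lra. }
specialize (H (- d / 2) ltac:(lra)). unfold gap at 1 in Hr.
apply Rabs_def2 in Hr. lra.
Qed.

(** * Series and their coefficients *)

Lemma is_series_C_eps (u : nat -> C) l :
  is_series (K := C_AbsRing) (V := C_NormedModule) u l <->
  forall eps, 0 < eps -> exists N, forall n, (N <= n)%nat ->
    Cmod (sum_n (G := C_AbelianGroup) u n - l) < eps.
Proof.
split.
- intros H eps He.
  assert (He' : 0 < eps / sqrt 2) by (apply Rdiv_lt_0_compat; [lra | apply sqrt_lt_R0; lra]).
  destruct (proj1 (filterlim_locally _ _) H (mkposreal _ He')) as [N HN].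
  exists N. intros n Hn. specialize (HN n Hn).
  apply (C_NormedModule_mixin_compat2 l) in HN.
  simpl in HN. replace (sqrt 2 * (eps / sqrt 2)) with eps in HN. exact HN.
  field. apply Rgt_not_eq, sqrt_lt_R0. lra.
- intros H. apply filterlim_locally. intros eps.
  destruct (H eps (cond_pos eps)) as [N HN].
  exists N. intros n Hn. apply C_NormedModule_mixin_compat1. apply (HN n Hn).
Qed.

Lemma sum_n_C_S (u : nat -> C) n :
  sum_n (G := C_AbelianGroup) u (S n) = (sum_n (G := C_AbelianGroup) u n + u (S n))%C.
Proof. exact (sum_Sn (G := C_AbelianGroup) u n). Qed.

Lemma sum_n_C_0 (u : nat -> C) : sum_n (G := C_AbelianGroup) u 0%nat = u 0%nat.
Proof. exact (sum_O (G := C_AbelianGroup) u). Qed.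

Lemma sum_n_R_S (u : nat -> R) n : sum_n u (S n) = sum_n u n + u (S n).
Proof. exact (sum_Sn (G := R_AbelianGroup) u n). Qed.

Lemma sum_n_R_0 (u : nat -> R) : sum_n u 0%nat = u 0%nat.
Proof. exact (sum_O (G := R_AbelianGroup) u). Qed.

Lemma sum_n_C_mult_r (u v : nat -> C) c n :
  (sum_n (G := C_AbelianGroup) (fun k => u k * v k) n * c)%C
   = sum_n (G := C_AbelianGroup) (fun k => u k * (v k * c))%C n.
Proof.
induction n as [|n IH].
- rewrite !sum_n_C_0. symmetry. apply Cmult_assoc.
- now rewrite !sum_n_C_S, <- IH, Cmult_plus_distr_r, Cmult_assoc.
Qed.

Lemma Cmod_sum_n_le (u : nat -> C) n :
  Cmod (sum_n (G := C_AbelianGroup) u n) <= sum_n (fun k => Cmod (u k)) n.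
Proof.
induction n as [|n IH].
- rewrite sum_n_C_0, sum_n_R_0. lra.
- rewrite sum_n_C_S, sum_n_R_S. eapply Rle_trans. apply Cmod_triangle. lra.
Qed.

Lemma Cmod_sum_n_tail_le (u : nat -> C) (v : nat -> R) n p : (forall k, Cmod (u k) <= v k) ->
  Cmod (sum_n (G := C_AbelianGroup) u (n + p) - sum_n (G := C_AbelianGroup) u n) <=
    sum_n v (n + p) - sum_n v n.
Proof.
intros H. induction p as [|p IH].
- rewrite Nat.add_0_r. unfold Cminus. rewrite Cplus_opp_r, Cmod_0. lra.
- rewrite Nat.add_succ_r, sum_n_C_S, sum_n_R_S.
  replace (_ + _ - _)%C with ((sum_n (G := C_AbelianGroup) u (n + p) - sum_n (G := C_AbelianGroup) u n)
    + u (S (n + p)))%C by ring.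
  eapply Rle_trans. apply Cmod_triangle. specialize (H (S (n + p))). lra.
Qed.

Lemma sum_n_le_Series (v : nat -> R) n : (forall k, 0 <= v k) -> ex_series v ->
  sum_n v n <= Series v.
Proof.
intros Hv Hs. apply Series_correct in Hs.
apply (is_lim_seq_incr_compare (sum_n v) (Series v) Hs).
intros k. rewrite sum_n_R_S. specialize (Hv (S k)). lra.
Qed.

Lemma Series_le_of_sum_n (v : nat -> R) M : ex_series v -> (forall n, sum_n v n <= M) -> Series v <= M.
Proof.
intros Hs H. apply Series_correct in Hs.
exact (is_lim_seq_le (sum_n v) (fun _ => M) (Series v) M H Hs (is_lim_seq_const M)).
Qed.

Lemma C_series_terms_bounded (u : nat -> C) l :
  is_series (K := C_AbsRing) (V := C_NormedModule) u l ->
  exists N, forall n, (N <= n)%nat -> Cmod (u n) <= 1.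
Proof.
intros H. destruct (proj1 (is_series_C_eps u l) H (1 / 2)) as [N HN]. lra.
exists (S N). intros n Hn. destruct n as [|n]. lia.
pose proof (HN n ltac:(lia)) as H1. pose proof (HN (S n) ltac:(lia)) as H2.
rewrite sum_n_C_S in H2. set (s := sum_n (G := C_AbelianGroup) u n) in *.
replace (u (S n)) with ((s + u (S n) - l) + - (s - l))%C by ring.
eapply Rle_trans. apply Cmod_triangle. rewrite Cmod_opp. lra.
Qed.

Lemma odd_majorant_term_ge_0 a r k : 0 <= r -> 0 <= odd_majorant_term a r k.
Proof. intros Hr. apply Rmult_le_pos. apply Cmod_ge_0. now apply pow_le. Qed.

(** Abel's comparison: convergence at the midpoint [t] of [r] and 1 eventually bounds the terms
    there by 1, so those at [r] are dominated by powers of [q = r / t]. *)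
Lemma odd_majorant_ex_series f a r : odd_taylor_expansion f a -> 0 <= r < 1 ->
  ex_series (odd_majorant_term a r).
Proof.
intros H Hr. set (t := (1 + r) / 2).
assert (Ht : 0 < t < 1) by (unfold t; lra). set (q := r / t).
assert (Hq : 0 <= q < 1).
{ unfold q. split. apply Rdiv_le_0_compat; lra. apply Rlt_div_l. lra. unfold t; lra. }
assert (Hd : unit_disk (RtoC t)) by (unfold unit_disk; rewrite Cmod_R, Rabs_pos_eq; lra).
destruct (C_series_terms_bounded _ _ (H _ Hd)) as [N HN].
apply (ex_series_incr_n _ N).
apply (ex_series_le (V := R_CompleteNormedModule)) with (b := fun k => q ^ k).
2:{ exists (/ (1 - q)). apply is_series_geom. rewrite Rabs_pos_eq; lra. }
intros k. specialize (HN (N + k)%nat ltac:(lia)).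
rewrite Cmod_mult, Cmod_pow, Cmod_R, Rabs_pos_eq in HN by lra.
change (Rabs (odd_majorant_term a r (N + k)) <= q ^ k).
rewrite Rabs_pos_eq by (apply odd_majorant_term_ge_0; lra).
unfold odd_majorant_term.
replace (r ^ (2 * (N + k) + 1)) with (t ^ (2 * (N + k) + 1) * q ^ (2 * (N + k) + 1)).
2:{ rewrite <- Rpow_mult_distr. f_equal. unfold q. field. lra. }
rewrite <- Rmult_assoc.
assert (P : forall n, 0 <= q ^ n <= 1).
{ intros n. split. apply pow_le; lra. rewrite <- (pow1 n). apply pow_incr; lra. }
assert (Q : q ^ (2 * (N + k) + 1) <= q ^ k).
{ replace (2 * (N + k) + 1)%nat with (k + (2 * N + k + 1))%nat by lia. rewrite pow_add.
  pose proof (P k). pose proof (P (2 * N + k + 1)%nat). nra. }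
rewrite <- (Rmult_1_l (q ^ k)).
apply Rmult_le_compat; auto; try apply P.
apply Rmult_le_pos. apply Cmod_ge_0. apply pow_le; lra.
Qed.

Lemma CInt_sum_n (c : nat -> C) (u : nat -> R -> C) a b n : (forall k, Cintegrable (u k) a b) ->
  Cintegrable (fun t => sum_n (G := C_AbelianGroup) (fun k => c k * u k t)%C n) a b /\
  CInt (fun t => sum_n (G := C_AbelianGroup) (fun k => c k * u k t)%C n) a b
   = sum_n (G := C_AbelianGroup) (fun k => c k * CInt (u k) a b)%C n.
Proof.
intros H.
assert (E : is_RInt (V := C_R_NormedModule) (fun t => sum_n (G := C_AbelianGroup) (fun k => c k * u k t)%C n)
  a b (sum_n (G := C_AbelianGroup) (fun k => c k * CInt (u k) a b)%C n)).
{ induction n as [|n IH].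
  - rewrite sum_n_C_0. apply (is_RInt_ext (V := C_R_NormedModule)) with (fun t => c 0%nat * u 0%nat t)%C.
    intros t _. now rewrite sum_n_C_0. now apply is_CInt_scal, CInt_correct.
  - rewrite sum_n_C_S.
    apply (is_RInt_ext (V := C_R_NormedModule)) with
      (fun t => sum_n (G := C_AbelianGroup) (fun k => c k * u k t)%C n + c (S n) * u (S n) t)%C.
    intros t _. now rewrite sum_n_C_S.
    apply (is_RInt_plus (V := C_R_NormedModule)); auto. now apply is_CInt_scal, CInt_correct. }
split. eexists; apply E. now apply is_CInt_unique.
Qed.

(** Holds by uniform convergence on [Cmod z <= 1/2]. *)
Lemma odd_taylor_integral g b (phi k : R -> C) M x y : odd_taylor_expansion g b -> x <= y ->
  (forall t, x <= t <= y -> Cmod (phi t) <= 1 / 2) -> (forall t, x <= t <= y -> Cmod (k t) <= M) ->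
  (forall m, Cintegrable (fun t => phi t ^ m * k t)%C x y) -> Cintegrable (fun t => g (phi t) * k t)%C x y ->
  is_series (K := C_AbsRing) (V := C_NormedModule)
   (fun j => b (2 * j + 1)%nat * CInt (fun t => phi t ^ (2 * j + 1) * k t)%C x y)%C
   (CInt (fun t => g (phi t) * k t)%C x y).
Proof.
intros Hg Hxy Hphi Hk Hm Hgi.
assert (Hex : ex_series (odd_majorant_term b (1 / 2))) by (apply (odd_majorant_ex_series g); auto; lra).
set (A := Series (odd_majorant_term b (1 / 2))).
(* Weierstrass bound, uniform in [z]: the tail is dominated by that of the majorant series at radius
   1/2. The slack [eps] covers replacing [g z] by a later partial sum. *)
assert (Tail : forall z n, Cmod z <= 1 / 2 ->
  Cmod (sum_n (G := C_AbelianGroup) (fun j => b (2 * j + 1)%nat * z ^ (2 * j + 1))%C n - g z)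
   <= A - sum_n (odd_majorant_term b (1 / 2)) n).
{ intros z n Hz. apply le_epsilon. intros eps He.
  assert (Hd : unit_disk z) by (unfold unit_disk; lra).
  destruct (proj1 (is_series_C_eps _ _) (Hg z Hd) eps He) as [N HN].
  specialize (HN (n + N)%nat ltac:(lia)).
  set (u := fun j => (b (2 * j + 1)%nat * z ^ (2 * j + 1))%C) in *.
  assert (T := Cmod_sum_n_tail_le u (odd_majorant_term b (1 / 2)) n N).
  assert (Hu : forall k0, Cmod (u k0) <= odd_majorant_term b (1 / 2) k0).
  { intros j. unfold u, odd_majorant_term. rewrite Cmod_mult, Cmod_pow.
    apply Rmult_le_compat_l. apply Cmod_ge_0. apply pow_incr. split; auto. apply Cmod_ge_0. }
  specialize (T Hu).
  assert (sum_n (odd_majorant_term b (1 / 2)) (n + N) <= A).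
  { apply sum_n_le_Series; auto. intros; apply odd_majorant_term_ge_0; lra. }
  replace (_ - _)%C with (- (sum_n (G := C_AbelianGroup) u (n + N) - sum_n (G := C_AbelianGroup) u n)
   + (sum_n (G := C_AbelianGroup) u (n + N) - g z))%C by ring.
  eapply Rle_trans. apply Cmod_triangle. rewrite Cmod_opp. lra. }
apply is_series_C_eps. intros eps He.
assert (HM : 0 <= M). { eapply Rle_trans. 2: apply (Hk x); lra. apply Cmod_ge_0. }
set (L := M * (y - x) + 1). assert (HL : 0 < L) by (unfold L; nra).
assert (Hlim : is_lim_seq (sum_n (odd_majorant_term b (1 / 2))) A) by exact (Series_correct _ Hex).
apply is_lim_seq_spec in Hlim. destruct (Hlim (mkposreal (eps / L) ltac:(apply Rdiv_lt_0_compat; lra))) as [N HN].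
simpl in HN. exists N. intros n Hn. specialize (HN n Hn).
destruct (CInt_sum_n (fun j => b (2 * j + 1)%nat) (fun j t => phi t ^ (2 * j + 1) * k t)%C x y n) as [I1 I2].
{ intros j. apply Hm. }
rewrite <- I2, <- CInt_minus by auto.
set (d := A - sum_n (odd_majorant_term b (1 / 2)) n).
assert (Hd0 : 0 <= d).
{ unfold d. assert (sum_n (odd_majorant_term b (1 / 2)) n <= A); [|lra].
  apply sum_n_le_Series; auto. intros; apply odd_majorant_term_ge_0; lra. }
assert (Hd1 : d < eps / L). { unfold d. apply Rabs_def2 in HN. lra. }
apply Rle_lt_trans with (d * M * (y - x)).
- apply CInt_bound; auto. now apply Cintegrable_minus.
  intros t Ht.
  rewrite <- (sum_n_C_mult_r (fun j => b (2 * j + 1)%nat) (fun j => phi t ^ (2 * j + 1))%C).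
  replace (_ - _)%C with ((sum_n (G := C_AbelianGroup) (fun k0 => b (2 * k0 + 1)%nat * phi t ^ (2 * k0 + 1))%C n
     - g (phi t)) * k t)%C by ring.
  rewrite Cmod_mult. apply Rmult_le_compat; auto; apply Cmod_ge_0.
- apply Rle_lt_trans with (d * L). unfold L; nra.
  replace eps with (eps / L * L) by (field; lra). apply Rmult_lt_compat_r; auto.
Qed.

Lemma finite_series (u : nat -> C) l n : is_series (K := C_AbsRing) (V := C_NormedModule) u l ->
  (forall k, (n < k)%nat -> u k = 0) -> l = sum_n (G := C_AbelianGroup) u n.
Proof.
intros H Hu.
assert (Hs : forall p, sum_n (G := C_AbelianGroup) u (n + p) = sum_n (G := C_AbelianGroup) u n).
{ induction p as [|p IH]. now rewrite Nat.add_0_r.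
  rewrite Nat.add_succ_r, sum_n_C_S, IH, Hu by lia. apply Cplus_0_r. }
symmetry. apply Ceq_minus. apply Cmod_zero_of_small with 1. intros eps He.
destruct (proj1 (is_series_C_eps _ _) H eps He) as [N HN].
specialize (HN (n + N)%nat ltac:(lia)). rewrite Hs in HN. lra.
Qed.

(** As [v] is bounded at [-oo], only its powers [v ^ m] with [m <= N] contribute to the
    [N]-th coefficient of [g (v * cexp)], which makes the series a finite sum. *)
Lemma composition_coefficient g b v K s i : odd_taylor_expansion g b ->
  periodic_holomorphic v -> s < 0 -> (forall x y : R, x <= s -> Cmod (v (x, y)) <= K) ->
  (forall y : R, Cmod (v (s, y) * cexp (s, y)) <= 1 / 2) ->
  Cintegrable (fun y => g (v (s, y) * cexp (s, y)) * cexp (- (s, y)) ^ (2 * i + 1))%C 0 (2 * PI) ->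
  vint (fun z => g (v z * cexp z) * cexp (- z) ^ (2 * i + 1))%C s =
  sum_n (G := C_AbelianGroup)
   (fun j => b (2 * j + 1)%nat * fourier (fun z => v z ^ (2 * j + 1))%C (2 * i + 1 - (2 * j + 1)) s)%C i.
Proof.
intros Hg Hv Hs HK Hhalf Hint. pose proof two_PI_pos.
assert (Hvc : periodic_holomorphic (fun z => v z * cexp z)%C)
 by (apply periodic_holomorphic_mult; auto; apply periodic_holomorphic_cexp).
assert (Hpow : forall m, periodic_holomorphic (fun z => (v z * cexp z) ^ m * cexp (- z) ^ (2 * i + 1))%C).
{ intros m. apply periodic_holomorphic_fourier.
  apply (periodic_holomorphic_pow (fun z => v z * cexp z)%C); auto. }
assert (S := odd_taylor_integral g b (fun y => v (s, y) * cexp (s, y))%C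
  (fun y => cexp (- (s, y)) ^ (2 * i + 1))%C (exp (- s) ^ (2 * i + 1)) 0 (2 * PI) Hg).
specialize (S ltac:(lra)). specialize (S (fun t _ => Hhalf t)).
assert (Hk : forall t, 0 <= t <= 2 * PI -> Cmod (cexp (- (s, t)) ^ (2 * i + 1))%C <= exp (- s) ^ (2 * i + 1)).
{ intros t _. rewrite Cmod_pow, Cmod_cexp. apply Rle_refl. }
assert (S' := S Hk (fun m => periodic_holomorphic_integrable _ s (Hpow m) Hs) Hint). clear S.
change (vint (fun z => g (v z * cexp z) * cexp (- z) ^ (2 * i + 1))%C s)
 with (CInt (fun t => g (v (s, t) * cexp (s, t)) * cexp (- (s, t)) ^ (2 * i + 1))%C 0 (2 * PI)).
rewrite (finite_series _ _ i S').
(* Here [j <= i], so the natural subtraction is exact: [2 * j + 1] of the negative powers cancel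
   those in the inner function, and the rest is the weight of [fourier]. *)
- apply sum_n_ext_loc. intros j Hj. f_equal. unfold fourier, vint.
  apply CInt_ext. lra. intros t _.
  replace (cexp (- (s, t)) ^ (2 * i + 1))%C with
   (cexp (- (s, t)) ^ (2 * j + 1) * cexp (- (s, t)) ^ (2 * i + 1 - (2 * j + 1)))%C.
  2:{ rewrite <- Cpow_add_r. f_equal. lia. }
  rewrite Cpow_mult_l.
  replace (v (s, t) ^ (2 * j + 1) * cexp (s, t) ^ (2 * j + 1) *
    (cexp (- (s, t)) ^ (2 * j + 1) * cexp (- (s, t)) ^ (2 * i + 1 - (2 * j + 1))))%C with
   (v (s, t) ^ (2 * j + 1) * ((cexp (- (s, t)) ^ (2 * j + 1) * cexp (s, t) ^ (2 * j + 1)) *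
     cexp (- (s, t)) ^ (2 * i + 1 - (2 * j + 1))))%C by ring.
  rewrite <- Cpow_mult_l, cexp_opp_l, Cpow_1_l. ring.
- intros j Hj.
  (* For [j > i] the positive power [2 * (j - i)] of [cexp] is left over, so the term is a
     coefficient of negative index of a power of [v]. *)
  assert (Z : vint (fun z => v z ^ (2 * j + 1) * cexp z ^ (2 * (j - i)))%C s = 0).
  { apply (vint_cexp_pow_zero (fun z => v z ^ (2 * j + 1))%C (K ^ (2 * j + 1)) s); auto; try lia.
    - now apply periodic_holomorphic_pow.
    - intros x y Hx. rewrite Cmod_pow. apply pow_incr. split. apply Cmod_ge_0. auto. }
  replace (CInt _ 0 (2 * PI)) with (RtoC 0). ring. rewrite <- Z. unfold vint.
  apply CInt_ext. lra. intros t _.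
  assert (U : (cexp (- (s, t)) ^ (2 * i + 1) * cexp (s, t) ^ (2 * i + 1))%C = 1)
   by (rewrite <- Cpow_mult_l, cexp_opp_l; apply Cpow_1_l).
  rewrite Cpow_mult_l.
  replace (cexp (s, t) ^ (2 * j + 1))%C with (cexp (s, t) ^ (2 * (j - i)) * cexp (s, t) ^ (2 * i + 1))%C.
  2:{ rewrite <- Cpow_add_r. f_equal. lia. }
  rewrite <- (Cmult_1_r (v (s, t) ^ (2 * j + 1) * cexp (s, t) ^ (2 * (j - i)))), <- U. ring.
Qed.

(** * Bohr's inequality *)

Lemma sum_n_R_le (u v : nat -> R) n : (forall k, (k <= n)%nat -> u k <= v k) -> sum_n u n <= sum_n v n.
Proof.
induction n as [|n IH]; intros H.
- rewrite !sum_n_R_0. apply H. lia.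
- rewrite !sum_n_R_S. apply Rplus_le_compat. apply IH. intros; apply H; lia. apply H; lia.
Qed.

Lemma sum_n_R_ext (u v : nat -> R) n : (forall k, (k <= n)%nat -> u k = v k) -> sum_n u n = sum_n v n.
Proof. apply (sum_n_ext_loc (G := R_AbelianGroup)). Qed.

Lemma sum_n_R_scal_l (c : R) (u : nat -> R) n : sum_n (fun k => c * u k) n = c * sum_n u n.
Proof. exact (sum_n_mult_l (K := R_Ring) c u n). Qed.

(** The geometric series
    [2 (1 - c j) (x + x^2 + ...)] with [x = r^2 <= 1/3] is at most [1 - c j]. *)
Lemma bohr_column_sum (c : nat -> R) j r n : 0 <= r -> r ^ 2 <= 1 / 3 ->
  (forall i, (i < j)%nat -> c i = 0) -> c j <= 1 ->
  (forall k, (1 <= k)%nat -> c (j + k)%nat <= 2 * (1 - c j)) ->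
  sum_n (fun i => c i * r ^ (2 * i + 1)) n <= r ^ (2 * j + 1).
Proof.
intros Hr Hr2 Hz Hj Hk.
assert (Pr : forall m, 0 <= r ^ m) by (intros; now apply pow_le).
assert (Z : forall m, (m < j)%nat -> sum_n (fun i => c i * r ^ (2 * i + 1)) m = 0).
{ induction m as [|m IH]; intros Hm.
  - rewrite sum_n_R_0, Hz by lia. apply Rmult_0_l.
  - rewrite sum_n_R_S, IH, Hz, Rmult_0_l by lia. apply Rplus_0_r. }
destruct (le_lt_dec j n) as [Hn|Hn]. 2:{ rewrite Z by lia. apply Pr. }
assert (P3 : forall m, 0 < (1 / 3) ^ m) by (intros; apply pow_lt; lra).
(* The factor [1 - (1 / 3) ^ m] is the exact value of 2(1/3 + ... + 1/3^m), so the induction closes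
   with no loss. *)
assert (G : forall m, sum_n (fun i => c i * r ^ (2 * i + 1)) (j + m) <=
  r ^ (2 * j + 1) * (c j + (1 - c j) * (1 - (1 / 3) ^ m))).
{ induction m as [|m IH].
  - rewrite Nat.add_0_r. simpl pow at 3. destruct j as [|j].
    + rewrite sum_n_R_0. lra.
    + rewrite sum_n_R_S, Z by lia. lra.
  - rewrite Nat.add_succ_r, sum_n_R_S.
    assert (T : c (S (j + m)) * r ^ (2 * S (j + m) + 1) <= r ^ (2 * j + 1) * (2 * (1 - c j) * (1 / 3) ^ S m)).
    { replace (2 * S (j + m) + 1)%nat with ((2 * j + 1) + 2 * S m)%nat by lia.
      rewrite pow_add, pow_mult. specialize (Hk (S m) ltac:(lia)). rewrite Nat.add_succ_r in Hk.
      assert ((r ^ 2) ^ S m <= (1 / 3) ^ S m) by (apply pow_incr; split; auto).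
      assert (0 <= (r ^ 2) ^ S m) by (apply pow_le, Pr).
      assert (0 <= (1 - c j) * (1 / 3) ^ S m) by (apply Rmult_le_pos; [lra | apply Rlt_le, P3]).
      replace (c (S (j + m)) * (r ^ (2 * j + 1) * (r ^ 2) ^ S m)) with
       (r ^ (2 * j + 1) * (c (S (j + m)) * (r ^ 2) ^ S m)) by ring.
      apply Rmult_le_compat_l; auto.
      apply Rle_trans with (2 * (1 - c j) * (r ^ 2) ^ S m).
      - apply Rmult_le_compat_r; auto.
      - apply Rmult_le_compat_l; auto. lra. }
    eapply Rle_trans. apply Rplus_le_compat; [exact IH | exact T]. right. simpl. field. }
specialize (G (n - j)%nat). replace (j + (n - j))%nat with n in G by lia.
eapply Rle_trans. apply G. specialize (P3 (n - j)%nat). specialize (Pr (2 * j + 1)%nat).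
assert (0 <= (1 - c j) * (1 / 3) ^ (n - j)) by (apply Rmult_le_pos; lra).
nra.
Qed.

(** Exchanging the triangular double sum groups the coefficients of one power of the inner function
    into a column, to which [bohr_column_sum] applies with weight [beta j]. *)
Lemma bohr_majorant_sum (alpha beta : nat -> R) (c : nat -> nat -> R) r n :
  0 <= r -> r ^ 2 <= 1 / 3 -> (forall j, 0 <= beta j) ->
  (forall i, alpha i <= sum_n (fun j => beta j * c i j) i) ->
  (forall j, c j j <= 1) ->
  (forall j k, (1 <= k)%nat -> c (j + k)%nat j <= 2 * (1 - c j j)) ->
  sum_n (fun i => alpha i * r ^ (2 * i + 1)) n <= sum_n (fun j => beta j * r ^ (2 * j + 1)) n.
Proof.
intros Hr Hr2 Hb Ha Hc Hck.
assert (Pr : forall m, 0 <= r ^ m) by (intros; now apply pow_le).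
(* Extension by zero turns the triangle into a square, where the sums can be switched. The entries
   of [c] with [i < j] are unconstrained; in the application truncated subtraction makes them equal
   to [c j j]. *)
set (d := fun i j => if le_lt_dec j i then c i j else 0).
assert (Hd : forall i j, (j <= i)%nat -> d i j = c i j).
{ intros i j H. unfold d. destruct le_lt_dec; auto; lia. }
assert (Hd0 : forall i j, (i < j)%nat -> d i j = 0).
{ intros i j H. unfold d. destruct le_lt_dec; auto; lia. }
assert (Hext : forall i p, sum_n (fun j => beta j * d i j) (i + p) = sum_n (fun j => beta j * c i j) i).
{ intros i p. induction p as [|p IH].
  - rewrite Nat.add_0_r. apply sum_n_R_ext. intros j Hj. now rewrite Hd.
  - rewrite Nat.add_succ_r, sum_n_R_S, IH, Hd0 by lia. rewrite Rmult_0_r. apply Rplus_0_r. }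
apply Rle_trans with (sum_n (fun i => sum_n (fun j => beta j * (d i j * r ^ (2 * i + 1))) n) n).
- apply sum_n_R_le. intros i Hi.
  replace (sum_n (fun j => beta j * (d i j * r ^ (2 * i + 1))) n) with
   (r ^ (2 * i + 1) * sum_n (fun j => beta j * d i j) n).
  + replace n with (i + (n - i))%nat by lia. rewrite Hext, Rmult_comm.
    apply Rmult_le_compat_l; auto.
  + rewrite <- sum_n_R_scal_l. apply sum_n_R_ext. intros j _. ring.
- rewrite sum_n_switch. apply sum_n_R_le. intros j Hj.
  rewrite sum_n_R_scal_l. apply Rmult_le_compat_l; auto.
  apply (bohr_column_sum (fun i => d i j)); auto.
  + rewrite Hd by lia. auto.
  + intros k Hk. rewrite !Hd by lia. auto.
Qed.

(** * Taylor coefficients on the disk as integrals over a vertical period *)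

Lemma periodic_holomorphic_pullback f : analytic_in_disk f -> periodic_holomorphic (fun z => f (cexp z)).
Proof.
intros Hf. split.
- intros z Hz. apply Cdiff_comp. 2: apply Cdiff_cexp.
  apply ex_derive_Cdiff, Hf. unfold unit_disk. rewrite Cmod_cexp, <- exp_0. now apply exp_increasing.
- intros x y. now rewrite cexp_period.
Qed.

Lemma fourier_one_0 s : fourier (fun _ => RtoC 1) 0 s = RtoC (2 * PI).
Proof.
rewrite fourier_zero. unfold vint. pose proof two_PI_pos.
rewrite (CInt_ext _ (fun t => RtoC 1 + RtoC t * RtoC 0)%C) by (try lra; intros; ring).
rewrite (is_CInt_unique _ _ _ _ (CInt_affine 1 0 0 (2 * PI))).
apply injective_projections; simpl; ring.
Qed.

(** Bohr's estimate for the constant 1 is extremal: its mean already attains the bound, so the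
    right-hand side is 0. *)
Lemma fourier_one_pos l s : (1 <= l)%nat -> s < 0 -> fourier (fun _ => RtoC 1) l s = 0.
Proof.
intros Hl Hs. pose proof two_PI_pos. apply Cmod_eq_0, Rle_antisym. 2: apply Cmod_ge_0.
assert (B := fourier_bound (fun _ => RtoC 1) 1 s l s 0 (periodic_holomorphic_const 1) Hs).
rewrite fourier_one_0, (Cmod_R (2 * PI)), Rabs_pos_eq in B by lra.
replace 0 with (2 * (2 * PI - 2 * PI)) by ring. apply B; auto; intros; rewrite Cmod_1; simpl; lra.
Qed.

(** The case of the identity as inner function, that is [v = 1]: in [composition_coefficient] only
    the diagonal term [j = i] survives. *)
Lemma disk_coefficient f a s i : odd_taylor_expansion f a -> analytic_in_disk f ->
  s < 0 -> exp s <= 1 / 2 ->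
  vint (fun z => f (cexp z) * cexp (- z) ^ (2 * i + 1))%C s = (a (2 * i + 1)%nat * RtoC (2 * PI))%C.
Proof.
intros Ha Hf Hs He. pose proof two_PI_pos.
assert (Hint := periodic_holomorphic_integrable _ s
  (periodic_holomorphic_fourier _ (2 * i + 1) (periodic_holomorphic_pullback f Hf)) Hs).
assert (E : forall y : R, (1 * cexp (s, y))%C = cexp (s, y)) by (intros; ring).
transitivity (vint (fun z => f (1 * cexp z) * cexp (- z) ^ (2 * i + 1))%C s).
{ unfold vint. apply CInt_ext. lra. intros t _. now rewrite E. }
rewrite (composition_coefficient f a (fun _ => RtoC 1) 1 s i Ha (periodic_holomorphic_const 1) Hs).
- assert (Z : forall j, (j < i)%nat -> sum_n (G := C_AbelianGroup)
    (fun j => a (2 * j + 1)%nat * fourier (fun _ => 1 ^ (2 * j + 1))%C (2 * i + 1 - (2 * j + 1)) s)%C j = RtoC 0).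
  { induction j as [|j IH]; intros Hj.
    - rewrite sum_n_C_0, Cpow_1_l, fourier_one_pos by (auto; lia). apply Cmult_0_r.
    - rewrite sum_n_C_S, IH, Cpow_1_l, fourier_one_pos, Cmult_0_r by (auto; lia). apply Cplus_0_r. }
  destruct i as [|i].
  + now rewrite sum_n_C_0, Cpow_1_l, Nat.sub_diag, fourier_one_0.
  + rewrite sum_n_C_S, Z, Cpow_1_l, Nat.sub_diag, fourier_one_0 by lia. apply Cplus_0_l.
- intros x y _. rewrite Cmod_1. lra.
- intros y. now rewrite E, Cmod_cexp.
- apply Cintegrable_ext with (2 := Hint). intros y. now rewrite E.
Qed.

Lemma sqrt3_bound r : 0 <= r <= 1 / sqrt 3 -> r < 1 /\ r ^ 2 <= 1 / 3.
Proof.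
intros [Hr Hr'].
assert (H3 : 0 < sqrt 3) by (apply sqrt_lt_R0; lra).
assert (E : sqrt 3 * sqrt 3 = 3) by (apply sqrt_sqrt; lra).
assert (H : (1 / sqrt 3) ^ 2 = 1 / 3).
{ replace ((1 / sqrt 3) ^ 2) with (1 / (sqrt 3 * sqrt 3)) by (field; lra). now rewrite E. }
assert (r ^ 2 <= 1 / 3). { rewrite <- H. apply pow_incr. lra. }
split; nra.
Qed.

(** Bounds w(zeta)/zeta near the centre of the disk, hence [v] near [Re z = -oo]. *)
Lemma Cmod_linear_bound_at_0 w : Cdiff w 0 -> w (RtoC 0) = RtoC 0 ->
  exists K delta, 0 < K /\ 0 < delta /\ forall z, Cmod z < delta -> Cmod (w z) <= K * Cmod z.
Proof.
intros Hw H0. destruct (Cdiff_lip _ _ Hw) as (K & d & HK & Hd & H).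
exists K, d. repeat split; auto. intros z Hz. specialize (H z Hz).
rewrite H0, Cplus_0_l in H. unfold Cminus in H. now rewrite Copp_0, Cplus_0_r in H.
Qed.

Theorem theorem2p4 (f g : C -> C) (a b : nat -> C)
  (hf : analytic_in_disk f) (hg : analytic_in_disk g)
  (hf_odd : odd_in_disk f) (hg_odd : odd_in_disk g)
  (hfa : odd_taylor_expansion f a) (hgb : odd_taylor_expansion g b)
  (hfg : subordinate f g) :
  forall r : R, 0 <= r <= 1 / sqrt 3 ->
    ex_series (odd_majorant_term a r) /\
    ex_series (odd_majorant_term b r) /\
    Series (odd_majorant_term a r) <= Series (odd_majorant_term b r).
Proof.
intros r Hr. destruct (sqrt3_bound r Hr) as [Hr1 Hr2].
assert (Ea : ex_series (odd_majorant_term a r)) by (apply (odd_majorant_ex_series f); auto; lra).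
assert (Eb : ex_series (odd_majorant_term b r)) by (apply (odd_majorant_ex_series g); auto; lra).
split; [exact Ea | split; [exact Eb |]].
destruct hfg as (w & Hw & Hw0 & Hw1 & Hwf).
pose proof two_PI_pos as Hpi.
assert (D0 : unit_disk 0) by (unfold unit_disk; rewrite Cmod_0; lra).
destruct (Cmod_linear_bound_at_0 w (ex_derive_Cdiff _ _ (Hw _ D0)) Hw0) as (K & d & HK & Hd & Hlin).
(* The circle of radius [exp s] must serve both functions: [exp s <= 1 / 2] for the series of [f],
   [exp s < d] for the linear bound on [w], and [K * exp s <= 1 / 2] to keep the values of [w] where
   the series of [g] converges uniformly. *)
assert (exists s, s < 0 /\ exp s <= 1 / 2 /\ exp s < d /\ K * exp s <= 1 / 2) as (s & Hs & Hs2 & Hsd & HsK).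
{ set (e := Rmin (1 / 2) (Rmin (d / 2) (1 / (2 * K)))).
  assert (He : 0 < e).
  { repeat apply Rmin_pos; try lra. apply Rdiv_lt_0_compat; lra. }
  pose proof (Rmin_l (1 / 2) (Rmin (d / 2) (1 / (2 * K)))) as R1.
  pose proof (Rmin_r (1 / 2) (Rmin (d / 2) (1 / (2 * K)))) as R2.
  pose proof (Rmin_l (d / 2) (1 / (2 * K))). pose proof (Rmin_r (d / 2) (1 / (2 * K))).
  fold e in R1, R2. exists (ln e). rewrite exp_ln by auto. repeat split; try lra.
  - rewrite <- ln_1. apply ln_increasing; lra.
  - replace (1 / 2) with (K * (1 / (2 * K))) by (field; lra). apply Rmult_le_compat_l; lra. }
(* Pullback of w(zeta)/zeta. It gets two bounds: [K] on the far left, which kills negative indices,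
   and [exp (- x)] up to the line [Re z = 0], which feeds Bohr's estimate. *)
set (v := fun z => (w (cexp z) * cexp (- z))%C).
assert (Hv : periodic_holomorphic v).
{ apply periodic_holomorphic_mult. now apply periodic_holomorphic_pullback.
  apply periodic_holomorphic_cexp_opp. }
assert (Hvw : forall z, (v z * cexp z)%C = w (cexp z)).
{ intros z. unfold v. rewrite <- Cmult_assoc, cexp_opp_l. ring. }
assert (HvK : forall x y : R, x <= s -> Cmod (v (x, y)) <= K).
{ intros x y Hx. unfold v. rewrite Cmod_mult, Cmod_cexp. simpl.
  assert (Hxs : exp x <= exp s) by (destruct Hx as [Hx | ->]; [apply Rlt_le, exp_increasing; auto | lra]).
  assert (Hl : Cmod (w (cexp (x, y))) <= K * exp x).
  { specialize (Hlin (cexp (x, y))). rewrite Cmod_cexp in Hlin. apply Hlin. simpl. lra. }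
  replace K with (K * exp x * exp (- x)).
  - apply Rmult_le_compat_r; auto. apply Rlt_le, exp_pos.
  - rewrite Rmult_assoc, <- exp_plus, Rplus_opp_r, exp_0. ring. }
assert (Hv1 : forall x y : R, x < 0 -> Cmod (v (x, y)) <= exp (- x)).
{ intros x y Hx. unfold v. rewrite Cmod_mult, Cmod_cexp. simpl.
  assert (Hl : Cmod (w (cexp (x, y))) <= 1).
  { apply Hw1. unfold unit_disk. rewrite Cmod_cexp, <- exp_0. now apply exp_increasing. }
  pose proof (exp_pos (- x)). nra. }
(* For [j <= i] the index is the even number [2 * (i - j)], and it is 0 on the diagonal. Dividing by
   2 pi in [c] gives moduli of genuine coefficients. *)
set (F := fun i j => fourier (fun z => v z ^ (2 * j + 1))%C (2 * i + 1 - (2 * j + 1)) s).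
set (c := fun i j => Cmod (F i j) / (2 * PI)).
assert (Hexp : forall i, Cmod (a (2 * i + 1)%nat) <= sum_n (fun j => Cmod (b (2 * j + 1)%nat) * c i j) i).
{ intros i.
  assert (Efg : forall y, f (cexp (s, y)) = g (v (s, y) * cexp (s, y))%C).
  { intros y. rewrite Hvw. apply Hwf. unfold unit_disk. rewrite Cmod_cexp. simpl. lra. }
  (* The same integral over the line [Re z = s] is evaluated twice, through the series of [f] and
     through that of [g] composed with [w]. *)
  assert (E : (a (2 * i + 1)%nat * RtoC (2 * PI))%C =
    sum_n (G := C_AbelianGroup) (fun j => b (2 * j + 1)%nat * F i j)%C i).
  { rewrite <- (disk_coefficient f a s i) by auto. unfold F.
    rewrite <- (composition_coefficient g b v K s i hgb Hv Hs HvK).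
    - unfold vint. apply CInt_ext. lra. intros t _. now rewrite Efg.
    - intros y. rewrite Hvw.
      eapply Rle_trans. apply Hlin. now rewrite Cmod_cexp. now rewrite Cmod_cexp.
    - apply Cintegrable_ext with (fun y => f (cexp (s, y)) * cexp (- (s, y)) ^ (2 * i + 1))%C.
      intros t. now rewrite Efg.
      apply (periodic_holomorphic_integrable _ s
        (periodic_holomorphic_fourier _ (2 * i + 1) (periodic_holomorphic_pullback f hf)) Hs). }
  apply (f_equal Cmod) in E. rewrite Cmod_mult, Cmod_R, Rabs_pos_eq in E by lra.
  apply Rmult_le_reg_r with (2 * PI). lra. rewrite E, Rmult_comm, <- sum_n_R_scal_l.
  eapply Rle_trans. apply Cmod_sum_n_le. apply sum_n_R_le. intros j _.
  rewrite Cmod_mult. unfold c. right. field. lra. }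
assert (Hbound : forall j l, (1 <= l)%nat ->
  Cmod (fourier (fun z => v z ^ (2 * j + 1))%C l s) <= 2 * (2 * PI - Cmod (F j j))).
{ intros j l Hl. unfold F. rewrite Nat.sub_diag.
  apply fourier_bound with (K := K ^ (2 * j + 1)) (s0 := s) (m := (2 * j + 1)%nat); auto.
  - now apply periodic_holomorphic_pow.
  - intros x y Hx. rewrite Cmod_pow. apply pow_incr. split. apply Cmod_ge_0. auto.
  - intros x y Hx. rewrite Cmod_pow. apply pow_incr. split. apply Cmod_ge_0. auto. }
apply Series_le_of_sum_n; auto. intros n.
apply Rle_trans with (sum_n (odd_majorant_term b r) n).
- apply (bohr_majorant_sum (fun i => Cmod (a (2 * i + 1)%nat)) (fun j => Cmod (b (2 * j + 1)%nat)) c); auto.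
  + lra.
  + intros j. apply Cmod_ge_0.
  (* The bound on the mean falls out of Bohr's estimate at any positive index, whose left-hand side
     is nonnegative. *)
  + intros j. specialize (Hbound j 1%nat (le_n 1)).
    pose proof (Cmod_ge_0 (fourier (fun z => v z ^ (2 * j + 1))%C 1 s)).
    unfold c. apply Rle_div_l; lra.
  + intros j k Hk. specialize (Hbound j (2 * (j + k) + 1 - (2 * j + 1))%nat ltac:(lia)).
    unfold c. apply Rle_div_l. lra.
    replace (2 * (1 - Cmod (F j j) / (2 * PI)) * (2 * PI)) with (2 * (2 * PI - Cmod (F j j))) by (field; lra).
    exact Hbound.
- apply sum_n_le_Series; auto. intros. apply odd_majorant_term_ge_0. lra.
Qed.
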